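(* Let $\mathcal C$ be a cube and $O_1,O_2$ two opposite vertices of it. Let $L=V_0V_1\dots V_5V_0$ be the closed polygonal line formed by edges of $\mathcal C$ passing through the remaining six vertices (indices mod $6$), so that $\mathcal C$ is the union of the six simplices $O_1O_2V_kV_{k+1}$, $k=0,\dots,5$ (the diagonal split). Let $S$ be the union of the six edges adjacent to $O_1$ or $O_2$, and $P$ the union of the six face diagonals adjacent to $O_1$ or $O_2$. If $f\colon\mathcal C\to\mathbb{R}$ is convex on each simplex $O_1O_2V_kV_{k+1}$, then $$\operatorname{Avg}(f,\mathcal C)\le\frac12\operatorname{Avg}(f,O_1O_2)+\frac12\operatorname{Avg}(f,L),\qquad \operatorname{Avg}(f,\mathcal C)\le\operatorname{Avg}(f,P),\qquad \operatorname{Avg}(f,\mathcal C)\le\operatorname{Avg}(f,S).$$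
   Context: $\operatorname{Avg}(f,\mathcal C)$ is the average over the cube with respect to volume; $\operatorname{Avg}(f,O_1O_2)$ is the average over the segment $O_1O_2$, and $\operatorname{Avg}(f,L)$, $\operatorname{Avg}(f,P)$, $\operatorname{Avg}(f,S)$ are averages over these unions of segments, all with respect to length. *)

(* Defs.v *)
From HB Require Import structures.
From mathcomp Require Import all_boot all_order all_algebra.
From mathcomp Require Import all_classical all_reals all_analysis.
Set Implicit Arguments. Unset Strict Implicit. Unset Printing Implicit Defensive.
Import Order.TTheory GRing.Theory Num.Theory.
Local Open Scope ring_scope.
Local Open Scope classical_set_scope.

Definition pt (R : realType) : Type := (R * R * R)%type.

Definition padd (R : realType) (p q : pt R) : pt R :=
  (p.1.1 + q.1.1, p.1.2 + q.1.2, p.2 + q.2).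
Definition pscale (R : realType) (t : R) (p : pt R) : pt R :=
  (t * p.1.1, t * p.1.2, t * p.2).
Definition psub (R : realType) (p q : pt R) : pt R := padd p (pscale (-1) q).
Definition pdot (R : realType) (p q : pt R) : R :=
  p.1.1 * q.1.1 + p.1.2 * q.1.2 + p.2 * q.2.

Definition leb3 (R : realType) :=
  ((@lebesgue_measure R \x @lebesgue_measure R) \x @lebesgue_measure R)%E.

Definition vol_avg (R : realType) (D : set (pt R)) (f : pt R -> R) : R :=
  Rintegral (@leb3 R) D f / fine (@leb3 R D).

Definition seg_len (R : realType) (A B : pt R) : R :=
  Num.sqrt (pdot (psub B A) (psub B A)).

(* average of f over segment AB w.r.t. length (via the affine
   constant-speed parametrization t |-> A + t (B - A), t in [0,1]) *)
Definition seg_avg (R : realType) (f : pt R -> R) (A B : pt R) : R :=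
  Rintegral (@lebesgue_measure R) `[0%R, 1%R]
    (fun t => f (padd A (pscale t (psub B A)))).

(* average w.r.t. length over a union of segments meeting only at
   endpoints: length-weighted mean of the segment averages *)
Definition union_avg (R : realType) (f : pt R -> R) (s : seq (pt R * pt R)) : R :=
  (\sum_(e <- s) seg_len e.1 e.2 * seg_avg f e.1 e.2) /
  (\sum_(e <- s) seg_len e.1 e.2).

Definition cube (R : realType) (O1 u1 u2 u3 : pt R) : set (pt R) :=
  [set p | exists x y z : R, [/\ 0 <= x <= 1, 0 <= y <= 1, 0 <= z <= 1 &
     p = padd O1 (padd (pscale x u1) (padd (pscale y u2) (pscale z u3)))]].

Definition is_cube (R : realType) (u1 u2 u3 : pt R) : Prop :=
  [/\ pdot u1 u2 = 0, pdot u1 u3 = 0 & pdot u2 u3 = 0] /\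
  [/\ pdot u1 u1 = pdot u2 u2, pdot u2 u2 = pdot u3 u3 & 0 < pdot u1 u1].

Definition cube_O2 (R : realType) (O1 u1 u2 u3 : pt R) : pt R :=
  padd O1 (padd u1 (padd u2 u3)).

Definition cube_V (R : realType) (O1 u1 u2 u3 : pt R) (k : nat) : pt R :=
  match (k %% 6)%N with
  | 0 => padd O1 u1
  | 1 => padd O1 (padd u1 u2)
  | 2 => padd O1 u2
  | 3 => padd O1 (padd u2 u3)
  | 4 => padd O1 u3
  | _ => padd O1 (padd u1 u3)
  end.

Definition simplex4 (R : realType) (A B C D : pt R) : set (pt R) :=
  [set p | exists a b c d : R, [/\ [&& 0 <= a, 0 <= b, 0 <= c & 0 <= d],
     a + b + c + d = 1 &
     p = padd (pscale a A) (padd (pscale b B) (padd (pscale c C) (pscale d D)))]].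

Definition convex_on (R : realType) (S : set (pt R)) (f : pt R -> R) : Prop :=
  forall x y t, S x -> S y -> 0 <= t <= 1 ->
    f (padd (pscale t x) (pscale (1 - t) y)) <= t * f x + (1 - t) * f y.

Definition cube_L (R : realType) (O1 u1 u2 u3 : pt R) : seq (pt R * pt R) :=
  [seq (cube_V O1 u1 u2 u3 k, cube_V O1 u1 u2 u3 k.+1) | k <- iota 0 6].

Definition cube_S (R : realType) (O1 u1 u2 u3 : pt R) : seq (pt R * pt R) :=
  let O2 := cube_O2 O1 u1 u2 u3 in
  [:: (O1, padd O1 u1); (O1, padd O1 u2); (O1, padd O1 u3);
      (O2, padd O1 (padd u2 u3)); (O2, padd O1 (padd u1 u3));
      (O2, padd O1 (padd u1 u2))].

Definition cube_P (R : realType) (O1 u1 u2 u3 : pt R) : seq (pt R * pt R) :=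
  let O2 := cube_O2 O1 u1 u2 u3 in
  [:: (O1, padd O1 (padd u1 u2)); (O1, padd O1 (padd u1 u3));
      (O1, padd O1 (padd u2 u3));
      (O2, padd O1 u1); (O2, padd O1 u2); (O2, padd O1 u3)].

(* Main.v *)
(* On a tetrahedron ABCD write a point as (1 - s) p + s q with p on AB and q on
   CD.  The normalized volume is 6 s (1 - s) ds dp dq, so integrating
   f <= (1 - s) f(p) + s f(q) bounds the average of f by
   (Avg(f, AB) + Avg(f, CD)) / 2.  Applying this to one of the three pairs of
   opposite edges of each of the six simplices of the diagonal split, which have
   equal volume, and averaging gives the three inequalities: the pairs
   (O1O2, V_kV_{k+1}) give the first one, and the remaining two pairs consist
   either of two edges of the cube or of two face diagonals.

   A function convex on a closed simplex is bounded and upper semicontinuous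
   there, hence Borel, so that the iterated integrals make sense. *)
Require Import Defs.
From HB Require Import structures.
From mathcomp Require Import all_boot all_order all_algebra.
From mathcomp Require Import all_classical all_reals all_analysis.
From mathcomp Require Import measurable_realfun ring lra.
Set Implicit Arguments. Unset Strict Implicit. Unset Printing Implicit Defensive.
Import Order.TTheory GRing.Theory Num.Theory.
Local Open Scope ring_scope.
Local Open Scope classical_set_scope.

(** * Affine changes of variables *)

(** Volume is given as an iterated product measure, so passing to edge coordinates requires a linear
    change of variables; it is derived from the one-dimensional affine rule by Tonelli and Gaussian
    elimination. Tonelli is applied to nonnegative integrands, so [f] is replaced by [f + K] with
    [K] a bound of [|f|] on the simplices; both sides of the final estimate grow by exactly [K].
    Nonnegativity also settles the faces shared by simplices: an integral over a covered set is at
    most the sum over the cover. A convex function may jump up at the boundary of a closed simplex,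
    so measurability cannot come from continuity. It has to be Borel up to the boundary, because the
    same function is restricted to edges, which are null for volume. *)

Section Affine1.
Variable R : realType.
Notation mu := (@lebesgue_measure R).
Notation T1 := (measurableTypeR R).

Lemma measurable_affine (a b : R) :
  measurable_fun [set: measurableTypeR R]
    ((fun x => a * x + b) : measurableTypeR R -> measurableTypeR R).
Proof. by apply: measurable_funD => //; exact: measurable_funM. Qed.

(** Both sides are measures in [A], and Lebesgue measure is determined by its values on the
    intervals []u, v]]. *)
Lemma lebesgue_measure_affine (a b : R) (A : set (measurableTypeR R)) : a != 0 ->
  measurable A ->
  mu A = (`|a|%:E * mu ((fun x => a * x + b)%R @^-1` A))%E.
Proof.
move=> a0 mA.
pose phi : measurableTypeR R -> measurableTypeR R := fun x => a * x + b.
have mphi : measurable_fun setT phi := measurable_affine a b.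
pose pf : {measure set T1 -> \bar R} :=
  measure_function_pushforward__canonical__measure_function_Measure mu mphi.
pose nu := mscale (NngNum (normr_ge0 a)) pf.
rewrite (_ : (_ * _)%E = nu A) //.
apply: lebesgue_measure_unique => //= _ [[u v]] _ <-.
rewrite /nu /mscale /= /pushforward lebesgue_measure_itv /= lte_fin.
have an0 : 0 < `|a| by rewrite normr_gt0.
(* A negative [a] exchanges the endpoints, so the preimage of []u, v]] is then closed on the left
   and open on the right. *)
case: (ltgtP a 0) => [aneg|apos|]; last by move/eqP; rewrite (negbTE a0).
  rewrite (_ : phi @^-1` _ = `[(v - b) / a, (u - b) / a[); last first.
    apply/seteqP; split => x /=; rewrite !in_itv/= /phi.
      by move=> /andP[? ?]; rewrite ler_ndivrMr // ltr_ndivlMr // ![x * a]mulrC; apply/andP; split; lra.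
    by rewrite ler_ndivrMr // ltr_ndivlMr // ![x * a]mulrC; move=> /andP[? ?]; apply/andP; split; lra.
  rewrite lebesgue_measure_itv /= lte_fin ltr_nM2r ?invr_lt0// ltrD2r.
  case: ifP => _; last by rewrite mule0.
  rewrite -!EFinB -EFinM; congr EFin; rewrite ltr0_norm //; field.
  by rewrite lt_eqF.
rewrite (_ : phi @^-1` _ = `](u - b) / a, (v - b) / a]); last first.
  apply/seteqP; split => x /=; rewrite !in_itv/= /phi.
    by move=> /andP[? ?]; rewrite ler_pdivlMr // ltr_pdivrMr // ![x * a]mulrC; apply/andP; split; lra.
  by rewrite ler_pdivlMr // ltr_pdivrMr // ![x * a]mulrC; move=> /andP[? ?]; apply/andP; split; lra.
rewrite lebesgue_measure_itv /= lte_fin ltr_pM2r ?invr_gt0// ltrD2r.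
case: ifP => _; last by rewrite mule0.
rewrite -!EFinB -EFinM; congr EFin; rewrite gtr0_norm //; field.
by rewrite gt_eqF.
Qed.

Local Open Scope ereal_scope.

Lemma ge0_integral_affine (a b : R) (F : T1 -> \bar R) : (a != 0)%R ->
  measurable_fun [set: measurableTypeR R] F -> (forall x, 0 <= F x) ->
  \int[mu]_x F x = `|a|%:E * \int[mu]_x F (a * x + b)%R.
Proof.
move=> a0 mF F0.
pose phi : measurableTypeR R -> measurableTypeR R := fun x => (a * x + b)%R.
have mphi : measurable_fun setT phi := measurable_affine a b.
have -> : \int[mu]_x F (a * x + b)%R = \int[pushforward mu phi]_x F x.
  by rewrite ge0_integral_pushforward //= ?preimage_setT.
pose pf : {measure set T1 -> \bar R} :=
  measure_function_pushforward__canonical__measure_function_Measure mu mphi.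
rewrite -(ge0_integral_mscale pf measurableT (NngNum (normr_ge0 a))) //.
apply: eq_measure_integral => A mA _.
rewrite [LHS](lebesgue_measure_affine b a0 mA).
by rewrite [RHS]/= /mscale.
Qed.

End Affine1.

(** * Tonelli for the three-dimensional product measure *)

Section Leb2.
Variable R : realType.
Notation mu := (@lebesgue_measure R).
Notation T1 := (measurableTypeR R).
Local Open Scope ereal_scope.

Lemma sigma_finite_leb2 : sigma_finite setT (mu \x mu).
Proof.
pose I (n : nat) : set T1 := `[(- n%:R)%R, n%:R%R]%classic.
exists (fun n => I n `*` I n).
  apply/seteqP; split => // -[x y] _.
  pose M : R := Num.max `|x : R|%R `|y : R|%R.
  exists (Num.truncn M).+1 => //.
  have := Num.Theory.truncnS_gt M.
  by rewrite gt_max => /andP[hx hy]; split; rewrite /I /= in_itv /= -ler_norml ltW.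
move=> n; split; first by apply: measurableX; exact: measurable_itv.
rewrite product_measure1E; [|exact: measurable_itv..].
rewrite /I [X in X * _]lebesgue_measure_itv [X in _ * X]lebesgue_measure_itv /=.
by case: ifP => _; rewrite ?mul0e // -EFinB -EFinM ltry.
Qed.

(* Canonical inference only finds sigma-finiteness of a product of two
   subprobabilities, so the structure is packed by hand. *)
Definition leb2 : {sigma_finite_measure set (T1 * T1)%type -> \bar R} :=
  HB.pack (mu \x mu)
    (Measure_isSigmaFinite.Build _ _ _ (mu \x mu) sigma_finite_leb2).

Lemma integral_leb2 (F : T1 * T1 -> \bar R) :
  \int[leb2]_p F p = \int[mu \x mu]_p F p.
Proof. by []. Qed.

Lemma ge0_integral_leb3 (F : T1 * T1 * T1 -> \bar R) :
  measurable_fun setT F -> (forall p, 0 <= F p) ->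
  \int[@leb3 R]_p F p = \int[mu]_x \int[mu]_y \int[mu]_z F (x, y, z).
Proof.
move=> mF F0.
have := @fubini_tonelli1 _ _ _ _ _ leb2 mu F mF F0.
have := @fubini_tonelli1 _ _ _ _ _ mu mu (fubini_F mu F).
move=> h1 h2; apply: etrans h2 _.
rewrite integral_leb2 h1 //.
- exact: (measurable_fun_fubini_tonelli_F (m2 := mu)).
- by move=> x; apply: integral_ge0.
Qed.

End Leb2.

(** * Elementary substitutions in iterated triple integrals *)

Section Triple.
Variable R : realType.
Notation mu := (@lebesgue_measure R).
Notation T1 := (measurableTypeR R).
Notation T3 := (measurableTypeR R * measurableTypeR R * measurableTypeR R)%type.
Local Open Scope ereal_scope.

Definition int3 (G : T3 -> \bar R) := \int[mu]_x \int[mu]_y \int[mu]_z G (x, y, z).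

Lemma measurable_int3_z (G : T3 -> \bar R) :
  measurable_fun [set: T3] G -> (forall p, 0 <= G p) ->
  measurable_fun [set: T1 * T1] (fun p => \int[mu]_z G (p, z)).
Proof. by move=> mG G0; exact: (measurable_fun_fubini_tonelli_F (m2 := mu)). Qed.

Lemma measurable_int3_yz (G : T3 -> \bar R) :
  measurable_fun [set: T3] G -> (forall p, 0 <= G p) ->
  measurable_fun [set: T1] (fun x => \int[mu]_y \int[mu]_z G (x, y, z)).
Proof.
move=> mG G0; apply: (measurable_fun_fubini_tonelli_F (m2 := mu) (fun p => \int[mu]_z G (p, z))).
  exact: measurable_int3_z.
by move=> x; apply: integral_ge0.
Qed.

Lemma int3_swap12 (G : T3 -> \bar R) :
  measurable_fun [set: T3] G -> (forall p, 0 <= G p) ->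
  int3 G = int3 (fun p => G (p.1.2, p.1.1, p.2)).
Proof.
move=> mG G0; apply: (fubini_tonelli (m1 := mu) (m2 := mu) (fun p => \int[mu]_z G (p, z))).
  exact: measurable_int3_z.
by move=> x; apply: integral_ge0.
Qed.

Lemma int3_swap23 (G : T3 -> \bar R) :
  measurable_fun [set: T3] G -> (forall p, 0 <= G p) ->
  int3 G = int3 (fun p => G (p.1.1, p.2, p.1.2)).
Proof.
move=> mG G0; apply: eq_integral => x _.
apply: (fubini_tonelli (m1 := mu) (m2 := mu) (fun p => G (x, p.1, p.2))) => //.
apply: measurableT_comp => //.
apply: measurable_fun_pair => //=.
by apply: measurable_fun_pair => //=; exact: measurable_cst.
Qed.

Lemma int3_affine (a b : R) (G : T3 -> \bar R) : (a != 0)%R ->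
  measurable_fun [set: T3] G -> (forall p, 0 <= G p) ->
  int3 G = `|a|%:E * int3 (fun p => G (a * p.1.1 + b, p.1.2, p.2)%R).
Proof.
move=> a0 mG G0; rewrite /int3 (ge0_integral_affine b a0) //.
- exact: measurable_int3_yz.
- by move=> x; do 2 apply: integral_ge0 => ? _.
Qed.

(** For fixed [x] this is a translation of [y] by [c * x], which preserves Lebesgue measure. *)
Lemma int3_shear (c : R) (G : T3 -> \bar R) :
  measurable_fun [set: T3] G -> (forall p, 0 <= G p) ->
  int3 G = int3 (fun p => G (p.1.1, p.1.2 + c * p.1.1, p.2)%R).
Proof.
move=> mG G0; apply: eq_integral => x _ /=.
rewrite (ge0_integral_affine (c * x) (oner_neq0 R)) //.
- by rewrite normr1 mul1e; apply: eq_integral => y _; rewrite mul1r.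
- apply: (measurable_fun_pair2 x (f := fun p => \int[mu]_z G (p, z))).
  exact: measurable_int3_z.
- by move=> y; apply: integral_ge0.
Qed.

End Triple.

(** * Change of variables in an affine frame *)

Section Frames.
Variable R : realType.
Notation mu := (@lebesgue_measure R).
Notation T1 := (measurableTypeR R).
Notation T3 := (measurableTypeR R * measurableTypeR R * measurableTypeR R)%type.
Implicit Types (o v w : pt R) (F : T3 -> \bar R).

Definition det3 v1 v2 v3 : R :=
  v1.1.1 * (v2.1.2 * v3.2 - v2.2 * v3.1.2)
  - v1.1.2 * (v2.1.1 * v3.2 - v2.2 * v3.1.1)
  + v1.2 * (v2.1.1 * v3.1.2 - v2.1.2 * v3.1.1).

Definition affmap o v1 v2 v3 (x : pt R) : pt R :=
  padd o (padd (pscale x.1.1 v1) (padd (pscale x.1.2 v2) (pscale x.2 v3))).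

Lemma measurable_lin3 (a b c d : R) :
  measurable_fun [set: T3] (fun p : T3 => a + b * p.1.1 + c * p.1.2 + d * p.2 : T1).
Proof.
have m1 : measurable_fun [set: T3] (fun p : T3 => p.1.1).
  exact: measurableT_comp.
have m2 : measurable_fun [set: T3] (fun p : T3 => p.1.2).
  exact: measurableT_comp.
apply: measurable_funD; last exact: measurable_funM.
apply: measurable_funD; last exact: measurable_funM.
by apply: measurable_funD => //; exact: measurable_funM.
Qed.

Lemma measurable_affmap o v1 v2 v3 :
  measurable_fun [set: T3] (affmap o v1 v2 v3 : T3 -> T3).
Proof.
apply: measurable_fun_pair; first apply: measurable_fun_pair.
- apply: eq_measurable_fun (measurable_lin3 o.1.1 v1.1.1 v2.1.1 v3.1.1).
  by move=> x _; rewrite /affmap /=; ring.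
- apply: eq_measurable_fun (measurable_lin3 o.1.2 v1.1.2 v2.1.2 v3.1.2).
  by move=> x _; rewrite /affmap /=; ring.
- apply: eq_measurable_fun (measurable_lin3 o.2 v1.2 v2.2 v3.2).
  by move=> x _; rewrite /affmap /=; ring.
Qed.

Definition change_of_frame o v1 v2 v3 := forall F,
  measurable_fun [set: T3] F -> (forall p, 0 <= F p)%E ->
  (\int[@leb3 R]_p F p = `|det3 v1 v2 v3|%:E * int3 (F \o affmap o v1 v2 v3))%E.

Lemma measurable_comp_affmap o v1 v2 v3 F : measurable_fun [set: T3] F ->
  measurable_fun [set: T3] (F \o affmap o v1 v2 v3).
Proof. by move=> mF; exact: measurableT_comp (measurable_affmap o v1 v2 v3). Qed.

Lemma change_of_frame_swap12 o v1 v2 v3 :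
  change_of_frame o v1 v2 v3 -> change_of_frame o v2 v1 v3.
Proof.
move=> h F mF F0; rewrite (h F mF F0).
rewrite (int3_swap12 (measurable_comp_affmap o v1 v2 v3 mF) (fun p => F0 _)).
have -> : `|det3 v1 v2 v3| = `|det3 v2 v1 v3|.
  by rewrite -[LHS]normrN; congr `|_|; rewrite /det3; ring.
set G := fun p => _; suff -> : G = F \o affmap o v2 v1 v3 by [].
apply/funext => p; rewrite /G /=; congr F.
by rewrite /affmap /padd /pscale /=; congr (_, _, _); ring.
Qed.

Lemma change_of_frame_swap23 o v1 v2 v3 :
  change_of_frame o v1 v2 v3 -> change_of_frame o v1 v3 v2.
Proof.
move=> h F mF F0; rewrite (h F mF F0).
rewrite (int3_swap23 (measurable_comp_affmap o v1 v2 v3 mF) (fun p => F0 _)).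
have -> : `|det3 v1 v2 v3| = `|det3 v1 v3 v2|.
  by rewrite -[LHS]normrN; congr `|_|; rewrite /det3; ring.
set G := fun p => _; suff -> : G = F \o affmap o v1 v3 v2 by [].
apply/funext => p; rewrite /G /=; congr F.
by rewrite /affmap /padd /pscale /=; congr (_, _, _); ring.
Qed.

(** One substitution serves two purposes: [a = 1] moves the origin along [v1], and [b = 0] rescales
    [v1]. *)
Lemma change_of_frame_affine (a b : R) o v1 v2 v3 : a != 0 ->
  change_of_frame o v1 v2 v3 ->
  change_of_frame (padd o (pscale b v1)) (pscale a v1) v2 v3.
Proof.
move=> a0 h F mF F0; rewrite (h F mF F0).
rewrite (int3_affine b a0 (measurable_comp_affmap o v1 v2 v3 mF) (fun p => F0 _)).
rewrite muleA -EFinM -normrM.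
have -> : det3 v1 v2 v3 * a = det3 (pscale a v1) v2 v3 by rewrite /det3 /=; ring.
set G := fun p => _; suff -> : G = F \o affmap (padd o (pscale b v1)) (pscale a v1) v2 v3 by [].
apply/funext => p; rewrite /G /=; congr F.
by rewrite /affmap /padd /pscale /=; congr (_, _, _); ring.
Qed.

Lemma change_of_frame_shear (c : R) o v1 v2 v3 :
  change_of_frame o v1 v2 v3 ->
  change_of_frame o (padd v1 (pscale c v2)) v2 v3.
Proof.
move=> h F mF F0; rewrite (h F mF F0).
rewrite (int3_shear c (measurable_comp_affmap o v1 v2 v3 mF) (fun p => F0 _)).
have -> : det3 v1 v2 v3 = det3 (padd v1 (pscale c v2)) v2 v3 by rewrite /det3 /=; ring.
set G := fun p => _; suff -> : G = F \o affmap o (padd v1 (pscale c v2)) v2 v3 by [].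
apply/funext => p; rewrite /G /=; congr F.
by rewrite /affmap /padd /pscale /=; congr (_, _, _); ring.
Qed.

Lemma change_of_frame_std :
  change_of_frame (0, 0, 0) (1, 0, 0) (0, 1, 0) (0, 0, 1).
Proof.
move=> F mF F0; rewrite ge0_integral_leb3 // /det3 /=.
rewrite (_ : _ - _ + _ = 1); last ring.
rewrite normr1 mul1e; set G := F \o _; suff -> : G = F by [].
apply/funext => -[[x y] z]; rewrite /G /=; congr F.
by rewrite /affmap /padd /pscale /=; congr (_, _, _); ring.
Qed.

End Frames.

(** * Gaussian elimination on frames *)

Section Elimination.
Variable R : realType.
Implicit Types (o v w : pt R) (a b c : R).

(* Stable under the elementary row operations, so that Gaussian elimination
   reaches every invertible frame from the standard one. *)
Definition good_frame v1 v2 v3 := forall o, change_of_frame o v1 v2 v3.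

Lemma good_swap12 v1 v2 v3 : good_frame v1 v2 v3 -> good_frame v2 v1 v3.
Proof. by move=> h o; exact: change_of_frame_swap12. Qed.

Lemma good_swap23 v1 v2 v3 : good_frame v1 v2 v3 -> good_frame v1 v3 v2.
Proof. by move=> h o; exact: change_of_frame_swap23. Qed.

Lemma good_swap13 v1 v2 v3 : good_frame v1 v2 v3 -> good_frame v3 v2 v1.
Proof. by move=> h; exact/good_swap12/good_swap23/good_swap12. Qed.

Lemma good_scale a v1 v2 v3 : a != 0 ->
  good_frame v1 v2 v3 -> good_frame (pscale a v1) v2 v3.
Proof.
move=> a0 h o; have := change_of_frame_affine 0 a0 (h o).
suff -> : padd o (pscale 0 v1) = o by [].
by case: o => [[? ?] ?]; rewrite /padd /pscale /=; congr (_, _, _); ring.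
Qed.

Lemma good_shear c v1 v2 v3 :
  good_frame v1 v2 v3 -> good_frame (padd v1 (pscale c v2)) v2 v3.
Proof. by move=> h o; exact: change_of_frame_shear. Qed.

(** The origin can only be moved along the first vector, so swaps bring each axis to the front in
    turn until the origin is an arbitrary [(x, y, z)]. *)
Lemma good_std : good_frame (1, 0, 0) (0, 1, 0) (0, 0, 1).
Proof.
case=> [[x y] z].
have h := change_of_frame_affine x (oner_neq0 R) (@change_of_frame_std R).
have {}h := change_of_frame_affine y (oner_neq0 R) (change_of_frame_swap12 h).
have {}h := change_of_frame_affine z (oner_neq0 R)
  (change_of_frame_swap12 (change_of_frame_swap23 h)).
have := change_of_frame_swap12 (change_of_frame_swap23 (change_of_frame_swap12 h)).
by rewrite /padd /pscale /= !(mulr0, mulr1, addr0, add0r).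
Qed.

Lemma eq_good_frame v1 v2 v3 w1 w2 w3 : good_frame v1 v2 v3 ->
  v1 = w1 -> v2 = w2 -> v3 = w3 -> good_frame w1 w2 w3.
Proof. by move=> h <- <- <-. Qed.

(** Scalings and shears build the triangular frame from the standard one. The shear by [b / d]
    creates the entry [b] but also [b * e / d] in the third coordinate, which the last shear
    corrects to [c]. *)
Lemma good_frame3 (a b c d e f : R) : a != 0 -> d != 0 -> f != 0 ->
  good_frame (a, b, c) (0, d, e) (0, 0, f).
Proof.
move=> a0 d0 f0.
have h := good_scale f0 (good_swap13 (@good_std)).
have {}h := good_shear (e / f) (good_scale d0 (good_swap12 h)).
have {}h := good_scale a0 (good_swap13 (good_swap12 h)).
have {}h := good_shear ((c - b * e / d) / f) (good_swap23 (good_shear (b / d) h)).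
apply: eq_good_frame (good_swap23 h) _ _ _;
  rewrite /padd /pscale /=; congr (_, _, _); field; rewrite ?d0 ?f0 //.
Qed.

Lemma good_frame2 (a b c d e g h : R) : a != 0 -> d * h - e * g != 0 ->
  good_frame (a, b, c) (0, d, e) (0, g, h).
Proof.
(* If [d = 0], the condition on the minor forces [g != 0], and exchanging the last two vectors
   supplies the pivot. *)
move=> a0; wlog d0 : d e g h / d != 0.
  move=> H D0; case: (eqVneq d 0) => d0; last exact: H.
  apply: good_swap23; apply: H.
    by apply: contra_neq D0 => ->; rewrite d0; ring.
  by rewrite -oppr_eq0 opprB mulrC [g * e]mulrC.
move=> D0; have f0 : h - e * g / d != 0.
  apply: contra_neq D0 => H; rewrite (_ : _ - _ = (h - e * g / d) * d); last by field.
  by rewrite H mul0r.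
have H := good_shear (g / d) (good_swap13 (good_frame3 b c e a0 d0 f0)).
apply: eq_good_frame (good_swap13 H) _ _ _;
  rewrite /padd /pscale /=; congr (_, _, _); field; rewrite ?a0 ?d0 //.
Qed.

(** Pivoting on the first coordinate of [v1] leaves a two by two minor equal to the determinant
    divided by that pivot, hence nonzero. *)
Lemma good_frame1 v1 v2 v3 : v1.1.1 != 0 -> det3 v1 v2 v3 != 0 -> good_frame v1 v2 v3.
Proof.
case: v1 => [[a b] c]; case: v2 => [[d e] f]; case: v3 => [[g h] i] /= a0 D0.
have H : (e - d / a * b) * (i - g / a * c) - (f - d / a * c) * (h - g / a * b) != 0.
  apply: contra_neq D0 => H; rewrite /det3 /=.
  transitivity (a * ((e - d / a * b) * (i - g / a * c) - (f - d / a * c) * (h - g / a * b))).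
    by field.
  by rewrite H mulr0.
have G := good_shear (d / a) (good_swap12 (good_frame2 b c a0 H)).
have {}G := good_shear (g / a) (good_swap13 G).
apply: eq_good_frame (good_swap23 (good_swap12 G)) _ _ _;
  rewrite /padd /pscale /=; congr (_, _, _); field; rewrite ?a0 ?d0 //.
Qed.

Lemma change_of_frameP o v1 v2 v3 : det3 v1 v2 v3 != 0 -> change_of_frame o v1 v2 v3.
Proof.
move=> D0; suff : good_frame v1 v2 v3 by exact.
have sw12 x y z : det3 x y z != 0 -> det3 y x z != 0.
  by rewrite -oppr_eq0 (_ : - _ = det3 y x z) // /det3; ring.
have sw13 x y z : det3 x y z != 0 -> det3 z y x != 0.
  by rewrite -oppr_eq0 (_ : - _ = det3 z y x) // /det3; ring.
have [h1|h1] := eqVneq v1.1.1 0; last exact: good_frame1.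
have [h2|h2] := eqVneq v2.1.1 0; last exact/good_swap12/good_frame1/sw12.
have [h3|h3] := eqVneq v3.1.1 0; last exact/good_swap13/good_frame1/sw13.
by move: D0; rewrite /det3 h1 h2 h3 !(mul0r, mulr0, subrr, addr0) eqxx.
Qed.

End Elimination.

(** * Measurability of convex functions on a simplex *)

Section StdSimplex.
Variable R : realType.
Notation T1 := (measurableTypeR R).
Notation T3 := (measurableTypeR R * measurableTypeR R * measurableTypeR R)%type.
Implicit Types (p q : pt R) (g : pt R -> R).

Definition std_simplex : set (pt R) :=
  [set p | [&& 0 <= p.1.1, 0 <= p.1.2, 0 <= p.2 & p.1.1 + p.1.2 + p.2 <= 1]].

Lemma convex_on_le (S : set (pt R)) g (M t : R) p q : convex_on S g ->
  S p -> S q -> 0 <= t <= 1 -> g p <= M -> g q <= M ->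
  g (padd (pscale t p) (pscale (1 - t) q)) <= M.
Proof.
move=> cg Sp Sq /[dup] t01 /andP[t0 t1] pM qM.
by apply: le_trans (cg p q t Sp Sq t01) _; nra.
Qed.

(** [convex_on] combines two points at a time, so the maximum of the four vertex values is
    propagated in stages: to one edge, to the face [x + y + z = 1] as a cone over that edge, and to
    the simplex as a cone from the origin over that face. *)
Lemma convex_on_bounded_above g : convex_on std_simplex g ->
  exists M, forall p, std_simplex p -> g p <= M.
Proof.
move=> cg.
pose M := Num.max (Num.max (g (0, 0, 0)) (g (1, 0, 0)))
  (Num.max (g (0, 1, 0)) (g (0, 0, 1))).
have g0M : g (0, 0, 0) <= M by rewrite !le_max lexx.
have g1M : g (1, 0, 0) <= M by rewrite !le_max lexx ?orbT.
have g2M : g (0, 1, 0) <= M by rewrite !le_max lexx ?orbT.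
have g3M : g (0, 0, 1) <= M by rewrite !le_max lexx ?orbT.
have T0 : std_simplex (0, 0, 0) by apply/and4P; split => /=; lra.
have T1' : std_simplex (1, 0, 0) by apply/and4P; split => /=; lra.
have T2 : std_simplex (0, 1, 0) by apply/and4P; split => /=; lra.
have T3' : std_simplex (0, 0, 1) by apply/and4P; split => /=; lra.
have edge x y : 0 <= x -> 0 <= y -> x + y = 1 -> g (x, y, 0) <= M.
  move=> x0 y0 xy.
  have -> : (x, y, 0) = padd (pscale x (1, 0, 0)) (pscale (1 - x) (0, 1, 0)).
    by rewrite /padd /pscale /=; congr (_, _, _); lra.
  by apply: (convex_on_le cg) => //; apply/andP; split; lra.
have face x y z : 0 <= x -> 0 <= y -> 0 <= z -> x + y + z = 1 -> g (x, y, z) <= M.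
  (* At [z = 1] the projection from the apex onto the edge is undefined, but the point is then the
     apex itself. *)
  move=> x0 y0 z0 xyz; have [z1|z1] := eqVneq z 1.
    have [-> ->] : x = 0 /\ y = 0 by split; lra.
    by rewrite z1.
  have z1' : 0 < 1 - z by rewrite subr_gt0 lt_neqAle z1 /=; lra.
  have xz : 0 <= x / (1 - z) by rewrite divr_ge0 // ltW.
  have yz : 0 <= y / (1 - z) by rewrite divr_ge0 // ltW.
  have xyz1 : x / (1 - z) + y / (1 - z) = 1.
    by rewrite -mulrDl (_ : x + y = 1 - z); [rewrite divff ?lt0r_neq0|lra].
  have -> : (x, y, z) = padd (pscale z (0, 0, 1))
      (pscale (1 - z) (x / (1 - z), y / (1 - z), 0)).
    by rewrite /padd /pscale /=; congr (_, _, _); field; rewrite ?(lt0r_neq0 z1') //.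
  apply: (convex_on_le cg) => //; [|by apply/andP; split; lra|exact: edge].
  by apply/and4P; split => /=; lra.
exists M => -[[x y] z] /and4P/= [x0 y0 z0 xyz].
have [s0|s0] := eqVneq (x + y + z) 0.
  have -> : x = 0 by lra.
  have -> : y = 0 by lra.
  by have -> : z = 0 by lra.
have s0' : 0 < x + y + z by rewrite lt_neqAle eq_sym s0 /=; lra.
set s := x + y + z in s0 s0' xyz *.
have xs : 0 <= x / s by rewrite divr_ge0 // ltW.
have ys : 0 <= y / s by rewrite divr_ge0 // ltW.
have zs : 0 <= z / s by rewrite divr_ge0 // ltW.
have xyzs : x / s + y / s + z / s = 1 by rewrite -!mulrDl divff.
have -> : (x, y, z) = padd (pscale s (x / s, y / s, z / s)) (pscale (1 - s) (0, 0, 0)).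
  by rewrite /padd /pscale /=; congr (_, _, _); field.
apply: (convex_on_le cg) => //; [|by apply/andP; split; lra|exact: face].
by apply/and4P; split => /=; lra.
Qed.

Lemma convex_on_bounded g : convex_on std_simplex g ->
  exists M, forall p, std_simplex p -> `|g p| <= M.
Proof.
move=> cg; have [M gM] := convex_on_bounded_above cg.
(* Lower bound: the centroid c is the combination p / 4 + 3 q / 4 of p and
   another point q of the simplex. *)
pose c : pt R := (4^-1, 4^-1, 4^-1).
(* The second bound comes from solving [g c <= g p / 4 + 3 * M / 4] for [- g p]. *)
exists (Num.max M (3 * M - 4 * g c)) => p Tp.
have {}gM q : std_simplex q -> g q <= M by exact: gM.
rewrite ler_norml; apply/andP; split; last by rewrite le_max gM.
rewrite lerNl le_max; apply/orP; right.
case: p Tp => [[x y] z] /[dup] Tp /and4P/= [x0 y0 z0 xyz].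
pose q : pt R := ((1 - x) / 3, (1 - y) / 3, (1 - z) / 3).
have Tq : std_simplex q by apply/and4P; split => /=; lra.
have h : 0 <= (4^-1 : R) <= 1 by apply/andP; split; lra.
have := cg (x, y, z) q 4^-1 Tp Tq h.
have -> : padd (pscale 4^-1 (x, y, z)) (pscale (1 - 4^-1) q) = c.
  by rewrite /padd /pscale /c /=; congr (_, _, _); field.
by have := gM q Tq; lra.
Qed.

(** Any rational in [[(1 - t) * b, b[] works. For [b = 0], a point on a face, this interval is
    empty; a negative threshold then does, since it holds for every [c >= 0]. *)
Lemma rat_approx (b t : R) : 0 <= b -> 0 < t ->
  exists r : rat, ratr r < b /\ forall c, 0 <= c -> ratr r < c -> (1 - t) * b <= c.
Proof.
move=> b0 t0; have [->|bn0] := eqVneq b 0.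
  by exists (-1); rewrite raddfN /= rmorph1; split => // c; rewrite mulr0.
have bp : 0 < b by rewrite lt_neqAle eq_sym bn0.
have /rat_in_itvoo[r] : (1 - t) * b < b by nra.
by rewrite in_itv /= => /andP[h1 h2]; exists r; split => // c _ ?; lra.
Qed.

(** The four quantities are the barycentric coordinates, the first one belonging to the vertex at
    the origin. Rational thresholds keep the family countable. *)
Definition bary_gt (r : rat * rat * rat * rat) : set (pt R) :=
  [set p | [&& ratr r.1.1.1 < 1 - p.1.1 - p.1.2 - p.2,
    ratr r.1.1.2 < p.1.1, ratr r.1.2 < p.1.2 & ratr r.2 < p.2]].

(* Upper semicontinuity: if the barycentric coordinates of q are at least (1 - t)
   times those of p, then q = (1 - t) p + t p' with p' in the simplex, and the
   last term is controlled by the upper bound of g. *)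
Lemma convex_on_strict_sublevel g (a : R) p : convex_on std_simplex g ->
  std_simplex p -> g p < a -> exists r, bary_gt r p /\
    forall q, std_simplex q -> bary_gt r q -> g q < a.
Proof.
case: p => [[x y] z] cg /[dup] Tp /and4P/= [x0 y0 z0 xyz] pa.
have [M gM] := convex_on_bounded_above cg.
set p := (x, y, z) in Tp pa *.
have pM := gM _ Tp.
(* [t] has to satisfy [t * (M - g p) < a - g p] and [0 < t < 1]. The extra terms [a - g p] and [1]
   in the denominator make both strict, also when [M = g p]. *)
pose t : R := (a - g p) / (a - g p + (M - g p) + 1).
have d0 : 0 < a - g p + (M - g p) + 1 by lra.
have t0 : 0 < t by rewrite divr_gt0 // subr_gt0.
have tE : t * (a - g p + (M - g p) + 1) = a - g p by rewrite divfK // gt_eqF.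
have ta : (1 - t) * g p + t * M < a by nra.
have t1 : t < 1 by nra.
have w0 : 0 <= 1 - x - y - z by lra.
have [r0 [pr0 r0P]] := rat_approx w0 t0.
have [r1 [pr1 r1P]] := rat_approx x0 t0.
have [r2 [pr2 r2P]] := rat_approx y0 t0.
have [r3 [pr3 r3P]] := rat_approx z0 t0.
exists (r0, r1, r2, r3); split; first by apply/and4P.
case=> [[x' y'] z'] /[dup] Tq /and4P/= [x'0 y'0 z'0 xyz'] /and4P/= [h0 h1 h2 h3].
have w'0 : 0 <= 1 - x' - y' - z' by lra.
have {}h0 := r0P _ w'0 h0; have {}h1 := r1P _ x'0 h1.
have {}h2 := r2P _ y'0 h2; have {}h3 := r3P _ z'0 h3.
pose q : pt R := ((x' - (1 - t) * x) / t, (y' - (1 - t) * y) / t, (z' - (1 - t) * z) / t).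
have Tq' : std_simplex q.
  apply/and4P; split => /=; try by rewrite divr_ge0 ?subr_ge0 // ltW.
  by rewrite -!mulrDl ler_pdivrMr //; lra.
have h : 0 <= 1 - t <= 1 by apply/andP; split; lra.
have := cg p q (1 - t) Tp Tq' h.
have -> : padd (pscale (1 - t) p) (pscale (1 - (1 - t)) q) = (x', y', z').
  by rewrite /padd /pscale /p /q /=; congr (_, _, _); field; rewrite gt_eqF.
have := gM q Tq'; nra.
Qed.

Lemma measurable_affine_form (h : T3 -> R) x y z w :
  (forall p, h p = x + y * p.1.1 + z * p.1.2 + w * p.2) ->
  measurable_fun [set: T3] h.
Proof.
move=> hE; apply: eq_measurable_fun (measurable_lin3 x y z w) => p _.
by rewrite hE.
Qed.

Lemma measurable_std_simplex : measurable (std_simplex : set T3).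
Proof.
pose h (p : T3) := [&& 0 <= p.1.1, 0 <= p.1.2, 0 <= p.2 & p.1.1 + p.1.2 + p.2 <= 1].
rewrite (_ : std_simplex = h @^-1` [set true]) // -[X in measurable X]setTI.
suff : measurable_fun [set: T3] h by exact.
apply: measurable_and; [|apply: measurable_and; [|apply: measurable_and]];
  apply: measurable_fun_ler => //.
- by apply: (@measurable_affine_form _ 0 1 0 0) => p; ring.
- by apply: (@measurable_affine_form _ 0 0 1 0) => p; ring.
- by apply: (@measurable_affine_form _ 0 1 1 1) => p; ring.
Qed.

Lemma measurable_bary_gt r : measurable (bary_gt r : set T3).
Proof.
pose h (p : T3) := [&& ratr r.1.1.1 < 1 - p.1.1 - p.1.2 - p.2,
    ratr r.1.1.2 < p.1.1, ratr r.1.2 < p.1.2 & ratr r.2 < p.2].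
rewrite (_ : bary_gt r = h @^-1` [set true]) // -[X in measurable X]setTI.
suff : measurable_fun [set: T3] h by exact.
apply: measurable_and; [|apply: measurable_and; [|apply: measurable_and]];
  apply: measurable_fun_ltr => //.
- by apply: (@measurable_affine_form _ 1 (-1) (-1) (-1)) => p; ring.
- by apply: (@measurable_affine_form _ 0 1 0 0) => p; ring.
- by apply: (@measurable_affine_form _ 0 0 1 0) => p; ring.
Qed.

(** A strict sublevel set is the union of the sets [bary_gt r] within the simplex over those [r] for
    which [g < a] holds there. There are countably many [r], and [unpickle] enumerates them. *)
Lemma measurable_fun_convex_on g : convex_on std_simplex g ->
  measurable_fun (std_simplex : set T3) (g : T3 -> R).
Proof.
move=> cg mT; apply: (measurability _ (RGenInftyO.measurableE R)) => //.
move=> _ [_ [a ->] <-].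
pose good r := forall q, std_simplex q -> bary_gt r q -> g q < a.
pose F (r : rat * rat * rat * rat) : set T3 :=
  if pselect (good r) then std_simplex `&` bary_gt r else set0.
pose G (n : nat) := if unpickle n is Some r then F r else set0.
rewrite (_ : _ `&` _ = \bigcup_n G n); last first.
  apply/seteqP; split => [p [Tp]|p [n _]].
    rewrite /= in_itv /= => pa; have [r [rp rP]] := convex_on_strict_sublevel cg Tp pa.
    exists (pickle r); first exact: I.
    by rewrite /G pickleK /F; case: pselect.
  rewrite /G; case: (unpickle n) => // r; rewrite /F; case: pselect => // gr [Tp rp].
  by split => //=; rewrite in_itv /=; exact: gr.
apply: bigcupT_measurable => n; rewrite /G; case: (unpickle n) => [r|]; last exact: measurable0.
rewrite /F; case: (pselect (good r)) => h; last exact: measurable0.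
by apply: measurableI => //; exact: measurable_bary_gt.
Qed.

End StdSimplex.

(** * The bound by two opposite edges *)

Section PairBound.
Variable R : realType.
Notation mu := (@lebesgue_measure R).
Notation T1 := (measurableTypeR R).
Notation T3 := (measurableTypeR R * measurableTypeR R * measurableTypeR R)%type.
Notation I := (`[0%R, 1%R]%classic : set T1).
Notation J := (`]0%R, 1%R[%classic : set T1).
Local Open Scope ereal_scope.

Lemma integral_vanish_off (D : set T1) (f : T1 -> \bar R) :
  (forall x, ~ D x -> f x = 0) -> \int[mu]_x f x = \int[mu]_(x in D) f x.
Proof.
move=> f0; rewrite [RHS]integral_mkcond; apply: eq_integral => x _.
by rewrite patchE; case: ifPn => // /negP Dx; apply: f0 => /mem_set.
Qed.

Lemma lebesgue_measure_I : mu I = 1.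
Proof. by rewrite lebesgue_measure_itv /= lte_fin ltr01 oppr0 adde0. Qed.

Lemma integral_affine_cst (a : R) (c : \bar R) (p : T1 -> \bar R) : (0 <= a)%R ->
  0 <= c -> measurable_fun I p -> (forall x, I x -> 0 <= p x) ->
  \int[mu]_(x in I) (a%:E * p x + c) = a%:E * \int[mu]_(x in I) p x + c.
Proof.
move=> a0 c0 mp p0.
have mI : measurable I by exact: measurable_itv.
rewrite (@ge0_integralD _ _ _ mu _ mI (fun x => a%:E * p x) (cst c)) //.
- rewrite (ge0_integralZl_EFin mu mI p0 mp a0) (integral_cst mu mI).
  by rewrite [X in _ + c * X]lebesgue_measure_I mule1.
- by move=> x Ix; apply: mule_ge0; [rewrite lee_fin|exact: p0].
- exact: measurable_funeM.
Qed.

(** The bound is a function of [r] plus a function of [t], and the unit interval has mass 1, so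
    integrating either variable leaves the other summand unchanged. *)
Lemma iterated_integral_le (H : T1 * T1 -> \bar R) (p q : T1 -> \bar R) (a b : R) :
  (0 <= a)%R -> (0 <= b)%R ->
  measurable_fun setT H -> (forall x, 0 <= H x) ->
  measurable_fun I p -> (forall x, I x -> 0 <= p x) ->
  measurable_fun I q -> (forall x, I x -> 0 <= q x) ->
  (forall r t, ~ (I r /\ I t) -> H (r, t) = 0) ->
  (forall r t, I r -> I t -> H (r, t) <= a%:E * p r + b%:E * q t) ->
  \int[mu]_r \int[mu]_t H (r, t) <=
    a%:E * \int[mu]_(r in I) p r + b%:E * \int[mu]_(t in I) q t.
Proof.
move=> a0 b0 mH H0 mp p0 mq q0 Hz Hle.
have mI : measurable I by exact: measurable_itv.
have mL : measurable_fun [set: T1] (fun r => \int[mu]_t H (r, t)).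
  exact: (measurable_fun_fubini_tonelli_F (m2 := mu)).
set Q := \int[mu]_(t in I) q t.
have Q0 : 0 <= Q by apply: integral_ge0.
have bQ0 : 0 <= b%:E * Q by apply: mule_ge0; rewrite ?lee_fin.
rewrite (@integral_vanish_off I); last first.
  move=> r Ir; apply: integral0_eq => t _; apply: Hz; tauto.
rewrite -(integral_affine_cst a0 bQ0 mp p0).
apply: ge0_le_integral => //.
- by move=> r _; apply: integral_ge0.
- exact: measurable_funS mL.
- by apply: emeasurable_funD => //; exact: measurable_funeM.
move=> r Ir; rewrite (@integral_vanish_off I); last first.
  by move=> t It; apply: Hz; tauto.
rewrite addeC -(@integral_affine_cst b (a%:E * p r) q) //; last first.
  by apply: mule_ge0; [rewrite lee_fin|exact: p0].
apply: ge0_le_integral => //.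
- by apply: measurable_funTS; exact: measurable_fun_pair2.
- by apply: emeasurable_funD => //; exact: measurable_funeM.
by move=> t It; rewrite addeC; exact: Hle.
Qed.

Lemma integral_beta (m n : nat) :
  \int[mu]_(s in `]0%R, 1%R[) (s ^+ m * (1 - s) ^+ n)%:E =
  ((m`! * n`!)%:R / ((m + n).+1)`!%:R)%:E.
Proof.
have mf D : measurable_fun D (fun s : T1 => (s ^+ m * (1 - s) ^+ n)%:E).
  apply/measurable_EFinP; apply: measurable_funM; apply: measurable_funX => //.
  exact: measurable_funB.
rewrite -beta_fun_fact EFin_beta_fun /= -(@integral_itv_bndoo _ 0%R 1%R _ true false); last exact: mf.
rewrite integral_mkcond; apply: eq_integral => s _.
by rewrite patchE [in RHS]/patch; case: ifP.
Qed.

Lemma int2_scale (G : T1 * T1 -> \bar R) (a b : R) : (0 < a)%R -> (0 < b)%R ->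
  measurable_fun setT G -> (forall x, 0 <= G x) ->
  \int[mu]_x \int[mu]_y G (x, y) =
  (a * b)%:E * \int[mu]_x \int[mu]_y G (a * x, b * y)%R.
Proof.
move=> a0 b0 mG G0.
have mL : measurable_fun [set: T1] (fun x => \int[mu]_y G (x, y)).
  exact: (measurable_fun_fubini_tonelli_F (m2 := mu)).
have L0 x : 0 <= \int[mu]_y G (x, y) by apply: integral_ge0.
apply: etrans (ge0_integral_affine 0 (lt0r_neq0 a0) mL L0) _.
rewrite (gtr0_norm a0) EFinM -muleA.
congr (_ * _).
have E x : \int[mu]_y G (a * x, y)%R = b%:E * \int[mu]_y G (a * x, b * y)%R.
  rewrite (ge0_integral_affine 0 (lt0r_neq0 b0)
    (measurable_fun_pair2 (a * x)%R mG) (fun y => G0 _)) (gtr0_norm b0).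
  by congr (_ * _); apply: eq_integral => y _; rewrite addr0.
have mG' : measurable_fun [set: T1 * T1] (fun p => G (a * p.1, b * p.2)%R).
  apply: (measurableT_comp mG (g := fun p : T1 * T1 => (a * p.1, b * p.2)%R)).
  by apply: measurable_fun_pair; exact: measurable_funM.
have mL' : measurable_fun [set: T1] (fun x => \int[mu]_y G (a * x, b * y)%R).
  exact: (measurable_fun_fubini_tonelli_F (m2 := mu) _ mG').
rewrite -(ge0_integralZl_EFin mu measurableT _ mL' (ltW b0)); last first.
  by move=> x _; apply: integral_ge0.
by apply: eq_integral => x _; rewrite addr0 E.
Qed.

(* The first coordinate s is the weight of the second edge; the other two are
   proportional to positions r and t along the two edges.  The constant is
   12^-1 = \int_0^1 s (1 - s) ^+ 2 ds. *)
Lemma int3_pair_le (G : T3 -> \bar R) (p q : T1 -> \bar R) :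
  measurable_fun [set: T3] G -> (forall x, 0 <= G x) ->
  measurable_fun I p -> (forall x, I x -> 0 <= p x) ->
  measurable_fun I q -> (forall x, I x -> 0 <= q x) ->
  (forall s x y, ~ I s -> G (s, x, y) = 0) ->
  (forall s r t, (0 < s < 1)%R -> ~ (I r /\ I t) ->
     G (s, (1 - s) * r, s * t)%R = 0) ->
  (forall s r t, (0 < s < 1)%R -> I r -> I t ->
     G (s, (1 - s) * r, s * t)%R <= (1 - s)%:E * p r + s%:E * q t) ->
  int3 G <= 12^-1%:E * (\int[mu]_(r in I) p r + \int[mu]_(t in I) q t).
Proof.
move=> mG G0 mp p0 mq q0 Gs Gz Gle.
pose K (s : T1) := \int[mu]_x \int[mu]_y G (s, x, y).
have mK : measurable_fun [set: T1] K := measurable_int3_yz mG G0.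
have K0 s : 0 <= K s by do 2 apply: integral_ge0 => ? _.
set P := \int[mu]_(r in I) p r; set Q := \int[mu]_(t in I) q t.
have P0 : 0 <= P by apply: integral_ge0.
have Q0 : 0 <= Q by apply: integral_ge0.
(* On the open interval both [1 - s] and [s] are positive and can serve as scales for the inner
   variables; the endpoints are null. *)
have -> : int3 G = \int[mu]_(s in J) K s.
  rewrite -(@integral_itv_bndoo _ 0%R 1%R _ true false); last exact: measurable_funTS.
  apply: integral_vanish_off => s Is; apply: integral0_eq => x _.
  by apply: integral0_eq => y _; exact: Gs.
(* The Jacobian [(1 - s) * s] of the inner rescaling, times the weight [1 - s] of [p] or [s] of
   [q]. *)
pose b1 (s : T1) : \bar R := (s ^+ 1 * (1 - s) ^+ 2)%:E.
pose b2 (s : T1) : \bar R := (s ^+ 2 * (1 - s) ^+ 1)%:E.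
have mb m n : measurable_fun J (fun s : T1 => (s ^+ m * (1 - s) ^+ n)%:E).
  apply/measurable_EFinP; apply: measurable_funM; apply: measurable_funX => //.
  exact: measurable_funB.
have b0 m n s : J s -> 0 <= (s ^+ m * (1 - s) ^+ n : R)%:E.
  rewrite /= in_itv /= => /andP[s0 s1].
  by rewrite lee_fin mulr_ge0 // exprn_ge0 // ?subr_ge0 ltW.
apply: (@le_trans _ _ (\int[mu]_(s in J) (b1 s * P + b2 s * Q))).
  apply: ge0_le_integral => //.
  - exact: measurable_funTS.
  - by apply: emeasurable_funD; apply: emeasurable_funM => //; exact: mb.
  move=> s; rewrite /= in_itv /= => s01; have /andP[s0 s1] := s01.
  have t0 : (0 < 1 - s)%R by rewrite subr_gt0.
  have mGs : measurable_fun [set: T1 * T1] (fun x => G (s, x.1, x.2)).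
    apply: measurableT_comp => //; apply: measurable_fun_pair => //=.
    by apply: measurable_fun_pair => //=; exact: measurable_cst.
  rewrite /K (@int2_scale (fun x => G (s, x.1, x.2)) _ _ t0 s0 mGs) //=.
  have mH : measurable_fun [set: T1 * T1] (fun x => G (s, (1 - s) * x.1, s * x.2)%R).
    apply: (measurableT_comp mGs (g := fun x : T1 * T1 => ((1 - s) * x.1, s * x.2)%R)).
    by apply: measurable_fun_pair; exact: measurable_funM.
  have := @iterated_integral_le (fun x => G (s, (1 - s) * x.1, s * x.2)%R) p q
    (1 - s) s (ltW t0) (ltW s0) mH (fun x => G0 _) mp p0 mq q0
    (fun r t => Gz s r t s01) (fun r t => Gle s r t s01).
  move=> /(lee_wpmul2l (x := ((1 - s) * s)%:E)) h.
  apply: le_trans (h _) _; first by rewrite lee_fin mulr_ge0 // ltW.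
  rewrite ge0_muleDr ?mule_ge0 ?lee_fin ?(ltW s0) ?(ltW t0) //.
  rewrite !muleA -!EFinM /b1 /b2 !expr1 !expr2.
  by rewrite (mulrC (1 - s)%R s) -!mulrA (mulrC (1 - s)%R s).
have mI : measurable J by exact: measurable_itv.
rewrite (@ge0_integralD _ _ _ mu _ mI (fun s => b1 s * P) (fun s => b2 s * Q)).
- rewrite (ge0_integralZr mu mI (mb 1%N 2%N) (b0 1%N 2%N) P0).
  rewrite (ge0_integralZr mu mI (mb 2%N 1%N) (b0 2%N 1%N) Q0).
  have e12 : (2%:R / 24%:R = 12^-1 :> R)%R by field.
  have f1 : ((1`! * 2`!)%:R / ((1 + 2).+1)`!%:R = 12^-1 :> R)%R by rewrite -e12.
  rewrite !integral_beta f1 [leRHS](ge0_muleDr _ P0 Q0).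
  exact: lexx.
- by move=> s s01; apply: mule_ge0 => //; exact: (b0 1%N 2%N).
- by apply: emeasurable_funM => //; exact: mb.
- by move=> s s01; apply: mule_ge0 => //; exact: (b0 2%N 1%N).
- by apply: emeasurable_funM => //; exact: mb.
Qed.

End PairBound.

(** * Nondegenerate simplices as affine images of the standard one *)

Section Simplex.
Variable R : realType.
Notation mu := (@lebesgue_measure R).
Notation T1 := (measurableTypeR R).
Notation T3 := (measurableTypeR R * measurableTypeR R * measurableTypeR R)%type.
Notation I := (`[0%R, 1%R]%classic : set T1).
Implicit Types (o v p q : pt R) (f : pt R -> R).

(** Cramer's rule for the inverse of [affmap]. *)
Definition affinv o v1 v2 v3 p : pt R :=
  let d := psub p o in let D := det3 v1 v2 v3 in
  (det3 d v2 v3 / D, det3 v1 d v3 / D, det3 v1 v2 d / D).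

Lemma affinvK o v1 v2 v3 p : det3 v1 v2 v3 != 0 ->
  affmap o v1 v2 v3 (affinv o v1 v2 v3 p) = p.
Proof.
case: o v1 v2 v3 p => [[x y] z] [[a1 a2] a3] [[b1 b2] b3] [[c1 c2] c3] [[p1 p2] p3].
rewrite /affmap /affinv /psub /padd /pscale /det3 /= => D0.
by congr (_, _, _); field.
Qed.

Lemma affmapK o v1 v2 v3 p : det3 v1 v2 v3 != 0 ->
  affinv o v1 v2 v3 (affmap o v1 v2 v3 p) = p.
Proof.
case: o v1 v2 v3 p => [[x y] z] [[a1 a2] a3] [[b1 b2] b3] [[c1 c2] c3] [[p1 p2] p3].
rewrite /affmap /affinv /psub /padd /pscale /det3 /= => D0.
by congr (_, _, _); field.
Qed.

Lemma measurable_affinv o v1 v2 v3 :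
  measurable_fun [set: T3] (affinv o v1 v2 v3 : T3 -> T3).
Proof.
pose e1 : pt R := (1, 0, 0); pose e2 : pt R := (0, 1, 0); pose e3 : pt R := (0, 0, 1).
pose D := det3 v1 v2 v3.
apply: measurable_fun_pair; first apply: measurable_fun_pair.
- apply: (@measurable_affine_form _ _ (- det3 o v2 v3 / D)
    (det3 e1 v2 v3 / D) (det3 e2 v2 v3 / D) (det3 e3 v2 v3 / D)) => p /=.
  by rewrite /D /det3 /psub /padd /pscale /=; ring.
- apply: (@measurable_affine_form _ _ (- det3 v1 o v3 / D)
    (det3 v1 e1 v3 / D) (det3 v1 e2 v3 / D) (det3 v1 e3 v3 / D)) => p /=.
  by rewrite /D /det3 /psub /padd /pscale /=; ring.
- apply: (@measurable_affine_form _ _ (- det3 v1 v2 o / D)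
    (det3 v1 v2 e1 / D) (det3 v1 v2 e2 / D) (det3 v1 v2 e3 / D)) => p /=.
  by rewrite /D /det3 /psub /padd /pscale /=; ring.
Qed.

Section Nondegenerate.
Variables A B C D : pt R.
Let T := simplex4 A B C D.
Let v1 := psub B A.
Let v2 := psub C A.
Let v3 := psub D A.
Hypothesis nd : det3 v1 v2 v3 != 0.

Lemma simplex4_affmap x : T (affmap A v1 v2 v3 x) <-> std_simplex x.
Proof.
split=> [[a [b [c [d [/and4P[a0 b0 c0 d0] abcd E]]]]]|].
  have -> : x = (b, c, d).
    rewrite -[LHS](affmapK A x nd) E -[RHS](affmapK A _ nd); congr affinv.
    have -> : a = 1 - b - c - d by lra.
    by rewrite /affmap /v1 /v2 /v3 /psub /padd /pscale /=; congr (_, _, _); ring.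
  by apply/and4P; split => //=; lra.
case: x => [[x y] z] /and4P/= [x0 y0 z0 xyz].
exists (1 - x - y - z), x, y, z; split; [by apply/and4P; split; lra|ring|].
by rewrite /affmap /v1 /v2 /v3 /psub /padd /pscale /=; congr (_, _, _); ring.
Qed.

Lemma simplex4_affinv : T = affinv A v1 v2 v3 @^-1` (@std_simplex R).
Proof.
apply/seteqP; split => p.
  by rewrite -{1}(affinvK A p nd) => /simplex4_affmap.
by move=> /simplex4_affmap; rewrite affinvK.
Qed.

Lemma convex_on_affmap f : convex_on T f ->
  convex_on (@std_simplex R) (f \o affmap A v1 v2 v3).
Proof.
move=> cf x y t /simplex4_affmap Tx /simplex4_affmap Ty t01 /=.
have := cf _ _ t Tx Ty t01.
suff -> : affmap A v1 v2 v3 (padd (pscale t x) (pscale (1 - t) y)) =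
  padd (pscale t (affmap A v1 v2 v3 x)) (pscale (1 - t) (affmap A v1 v2 v3 y)) by [].
by rewrite /affmap /psub /padd /pscale /=; congr (_, _, _); ring.
Qed.

Lemma measurable_simplex4 : measurable (T : set T3).
Proof.
rewrite simplex4_affinv -[X in measurable X]setTI.
by apply: measurable_affinv => //; exact: measurable_std_simplex.
Qed.

Lemma measurable_fun_simplex4 f : convex_on T f ->
  measurable_fun (T : set T3) (f : T3 -> R).
Proof.
move=> cf; have -> : f = (f \o affmap A v1 v2 v3) \o affinv A v1 v2 v3.
  by apply/funext => p /=; rewrite affinvK.
apply: (measurable_comp (F := (@std_simplex R : set T3))).
- exact: measurable_std_simplex.
- by move=> _ [p Tp <-]; rewrite simplex4_affinv in Tp; exact: Tp.
- exact: measurable_fun_convex_on (convex_on_affmap cf).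
- exact: measurable_funTS (measurable_affinv _ _ _ _).
Qed.

Lemma bounded_simplex4 f : convex_on T f -> exists M, forall p, T p -> `|f p| <= M.
Proof.
move=> cf; have [M fM] := convex_on_bounded (convex_on_affmap cf).
exists M => p; rewrite simplex4_affinv => /fM /=.
by rewrite affinvK.
Qed.

Lemma simplex4_AB (r : R) : I r -> T (padd A (pscale r (psub B A))).
Proof.
rewrite /= in_itv /= => /andP[r0 r1].
exists (1 - r), r, 0, 0; split; [by apply/and4P; split; lra|ring|].
by rewrite /psub /padd /pscale /=; congr (_, _, _); ring.
Qed.

Lemma simplex4_CD (r : R) : I r -> T (padd C (pscale r (psub D C))).
Proof.
rewrite /= in_itv /= => /andP[r0 r1].
exists 0, 0, (1 - r), r; split; [by apply/and4P; split; lra|ring|].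
by rewrite /psub /padd /pscale /=; congr (_, _, _); ring.
Qed.

(** Borel measurability on the whole closed simplex composes with the affine parametrization;
    measurability up to null sets would say nothing about an edge. *)
Lemma measurable_segment f (X Y : pt R) : convex_on T f ->
  (forall r, I r -> T (padd X (pscale r (psub Y X)))) ->
  measurable_fun I (fun r => f (padd X (pscale r (psub Y X)))).
Proof.
move=> cf XY.
apply: (measurable_comp (F := (T : set T3)) (f := f)
  (g := fun r : T1 => (padd X (pscale r (psub Y X)) : T3))).
- exact: measurable_simplex4.
- by move=> _ [r Ir <-]; exact: XY.
- exact: measurable_fun_simplex4.
- apply: measurable_funTS; apply: measurable_fun_pair; first apply: measurable_fun_pair.
  + by apply: measurable_funD => //=; exact: measurable_funM.
  + by apply: measurable_funD => //=; exact: measurable_funM.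
  + by apply: measurable_funD => //=; exact: measurable_funM.
Qed.

End Nondegenerate.
End Simplex.

(** * The integral over one simplex *)

Section SimplexBound.
Variable R : realType.
Notation mu := (@lebesgue_measure R).
Notation T1 := (measurableTypeR R).
Notation T3 := (measurableTypeR R * measurableTypeR R * measurableTypeR R)%type.
Notation I := (`[0%R, 1%R]%classic : set T1).

(** In this frame [s] is the total barycentric weight of [C] and [D], while [x] and [y] are the
    weights of [B] and [D]. The four conditions say that the weights of [B], [C], [D], [A] are
    nonnegative. *)
Lemma simplex4_pair_coords A B C D (s x y : R) :
  det3 (psub B A) (psub C A) (psub D A) != 0 ->
  simplex4 A B C D (affmap A (psub C A) (psub B A) (psub D C) (s, x, y)) <->
  [&& 0 <= x, 0 <= s - y, 0 <= y & x + s <= 1].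
Proof.
move=> nd.
have -> : affmap A (psub C A) (psub B A) (psub D C) (s, x, y) =
    affmap A (psub B A) (psub C A) (psub D A) (x, s - y, y).
  by rewrite /affmap /psub /padd /pscale /=; congr (_, _, _); ring.
apply: (iff_trans (simplex4_affmap nd _)).
by rewrite /std_simplex /= (_ : x + (s - y) + y = x + s) //; ring.
Qed.

(** The constant is the volume [|det3| / 6] of the simplex times the factor one half of the mean of
    the two edge averages. Nonnegativity of [f] on the simplex makes its extension by zero a
    legitimate integrand for the change of frame. *)
Lemma simplex_integral_le A B C D (f : pt R -> R) :
  det3 (psub B A) (psub C A) (psub D A) != 0 ->
  convex_on (simplex4 A B C D) f ->
  (forall p, simplex4 A B C D p -> 0 <= f p) ->
  (\int[@leb3 R]_(p in simplex4 A B C D) (f p)%:E <=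
   (`|det3 (psub B A) (psub C A) (psub D A)| / 12)%:E *
   (\int[mu]_(r in I) (f (padd A (pscale r (psub B A))))%:E +
    \int[mu]_(r in I) (f (padd C (pscale r (psub D C))))%:E))%E.
Proof.
move=> nd cf f0; set T := simplex4 A B C D in cf f0 *.
pose F : T3 -> \bar R := (EFin \o f) \_ T.
have mT : measurable (T : set T3) by exact: measurable_simplex4.
have FT p : T p -> F p = (f p)%:E by move=> Tp; rewrite /F patchE mem_set.
have FnT p : ~ T p -> F p = 0%E.
  by move=> Tp; rewrite /F patchE memNset.
have F0 p : (0 <= F p)%E.
  have [Tp|Tp] := pselect (T p); last by rewrite FnT.
  by rewrite FT // lee_fin f0.
have mF : measurable_fun [set: T3] F.
  have := measurable_fun_simplex4 nd cf.
  by move=> /measurable_EFinP /(measurable_restrictT _ mT).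
have D' : det3 (psub C A) (psub B A) (psub D C) = - det3 (psub B A) (psub C A) (psub D A).
  by rewrite /det3 /psub /padd /pscale /=; ring.
have nd' : det3 (psub C A) (psub B A) (psub D C) != 0 by rewrite D' oppr_eq0.
rewrite [leLHS](_ : _ = \int[@leb3 R]_p F p)%E; last first.
  exact: (integral_mkcond (mu := @leb3 R)).
rewrite (change_of_frameP A nd' mF F0) D' normrN EFinM -muleA.
apply: lee_wpmul2l; first by rewrite lee_fin.
pose phi := affmap A (psub C A) (psub B A) (psub D C).
apply: int3_pair_le.
- exact: measurable_comp_affmap.
- by move=> x; exact: F0.
- apply/measurable_EFinP; apply: (measurable_segment nd) => // r; exact: simplex4_AB.
- by move=> r Ir; rewrite lee_fin f0 //; exact: simplex4_AB.
- apply/measurable_EFinP; apply: (measurable_segment nd) => // r; exact: simplex4_CD.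
- by move=> r Ir; rewrite lee_fin f0 //; exact: simplex4_CD.
- move=> s x y Is; apply: FnT => /(simplex4_pair_coords _ _ _ nd)/and4P[? ? ? ?].
  by apply: Is; rewrite /= in_itv /=; apply/andP; split; lra.
- move=> s r t /andP[s0 s1] Irt.
  apply: FnT => /(simplex4_pair_coords _ _ _ nd)/and4P[h1 h2 h3 h4].
  apply: Irt; rewrite /= !in_itv /=; split; apply/andP; split; nra.
move=> s r t /andP[s0 s1] Ir It.
have TAB := simplex4_AB A B C D Ir; have TCD := simplex4_CD A B C D It.
have s01 : 0 <= 1 - s <= 1 by apply/andP; split; lra.
have E2 : phi (s, (1 - s) * r, s * t) =
    padd (pscale (1 - s) (padd A (pscale r (psub B A))))
      (pscale (1 - (1 - s)) (padd C (pscale t (psub D C)))).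
  by rewrite /phi /affmap /psub /padd /pscale /=; congr (_, _, _); ring.
have Tp : T (phi (s, (1 - s) * r, s * t)).
  apply/(simplex4_pair_coords _ _ _ nd).
  move: Ir It; rewrite /= !in_itv /= => /andP[r0 r1] /andP[t0 t1].
  by apply/and4P; split; nra.
rewrite -[leLHS]/(F (phi (s, (1 - s) * r, s * t))) (FT _ Tp) E2 -!EFinM -EFinD lee_fin.
by apply: le_trans (cf _ _ _ TAB TCD s01) _; rewrite subKr.
Qed.

End SimplexBound.

(** * The cube *)

Section Averages.
Variable R : realType.
Notation mu := (@lebesgue_measure R).
Notation T1 := (measurableTypeR R).
Notation T3 := (measurableTypeR R * measurableTypeR R * measurableTypeR R)%type.
Notation I := (`[0%R, 1%R]%classic : set T1).

Lemma integrable_of_bounded d (T : measurableType d)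
  (m : {measure set T -> \bar R}) (D : set T) (f : T -> R) (M : R) :
  measurable D -> (m D < +oo)%E -> measurable_fun D f ->
  (forall x, D x -> `|f x| <= M) -> m.-integrable D (EFin \o f).
Proof.
move=> mD Doo mf fM; apply: measurable_bounded_integrable => //.
exists M; split; first exact: num_real.
by move=> x Mx y Dy /=; apply: le_trans (fM y Dy) (ltW Mx).
Qed.

Definition seg (X Y : pt R) (r : R) := padd X (pscale r (psub Y X)).

Lemma seg_integrable A B C D (f : pt R -> R) X Y :
  det3 (psub B A) (psub C A) (psub D A) != 0 ->
  convex_on (simplex4 A B C D) f ->
  (forall r, I r -> simplex4 A B C D (seg X Y r)) ->
  mu.-integrable I (EFin \o (f \o seg X Y)).
Proof.
move=> nd cf XY; have [M fM] := bounded_simplex4 nd cf.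
apply: (@integrable_of_bounded _ _ mu I (f \o seg X Y) M).
- exact: measurable_itv.
- by rewrite [X in (X < _)%E]lebesgue_measure_I ltry.
- by have := measurable_segment nd cf XY.
- by move=> r Ir; apply: fM; exact: XY.
Qed.

Lemma seg_avg_shift (f : pt R -> R) (K : R) X Y :
  mu.-integrable I (EFin \o (f \o seg X Y)) ->
  seg_avg (fun p => f p + K) X Y = seg_avg f X Y + K.
Proof.
move=> fi; rewrite /seg_avg.
have ci : mu.-integrable I (EFin \o (cst K : T1 -> R)).
  apply: (@integrable_of_bounded _ _ mu I (cst K) `|K|) => //.
  by rewrite [X in (X < _)%E]lebesgue_measure_I ltry.
rewrite (@RintegralD _ _ _ mu I (f \o seg X Y) (cst K)) //.
rewrite (@Rintegral_cst _ _ _ mu I) //.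
by rewrite [X in _ + K * fine X]lebesgue_measure_I mulr1.
Qed.

Lemma convex_on_shift (S : set (pt R)) (f : pt R -> R) (K : R) :
  convex_on S f -> convex_on S (fun p => f p + K).
Proof.
move=> cf x y t Sx Sy t01; have := cf x y t Sx Sy t01.
by move=> h; apply: le_trans (lerD h (lexx K)) _; rewrite le_eqVlt; apply/orP; left; apply/eqP; ring.
Qed.

(** The squared determinant is the Gram determinant, of which orthogonality leaves only the diagonal
    product. *)
Lemma det3_sqr (u1 u2 u3 : pt R) : pdot u1 u2 = 0 -> pdot u1 u3 = 0 ->
  pdot u2 u3 = 0 -> det3 u1 u2 u3 ^+ 2 = pdot u1 u1 * pdot u2 u2 * pdot u3 u3.
Proof.
move=> h12 h13 h23.
have -> : det3 u1 u2 u3 ^+ 2 = pdot u1 u1 * pdot u2 u2 * pdot u3 u3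
  + 2 * pdot u1 u2 * pdot u2 u3 * pdot u1 u3 - pdot u1 u1 * pdot u2 u3 ^+ 2
  - pdot u2 u2 * pdot u1 u3 ^+ 2 - pdot u3 u3 * pdot u1 u2 ^+ 2.
  by rewrite /det3 /pdot; ring.
by rewrite h12 h13 h23; ring.
Qed.

Lemma is_cube_det3 (u1 u2 u3 : pt R) : is_cube u1 u2 u3 -> det3 u1 u2 u3 != 0.
Proof.
move=> [[h12 h13 h23] [n12 n23 n0]].
rewrite -sqrf_eq0 det3_sqr // -n23 -n12.
by rewrite !mulf_neq0 // gt_eqF.
Qed.

Section Parallelepiped.
Variables O1 u1 u2 u3 : pt R.
Hypothesis nd : det3 u1 u2 u3 != 0.
Let C := cube O1 u1 u2 u3.

Lemma cube_affinv : C = affinv O1 u1 u2 u3 @^-1` ((I `*` I) `*` I).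
Proof.
apply/seteqP; split => p.
  move=> [x [y [z [x01 y01 z01 ->]]]].
  change (((I `*` I) `*` I) (affinv O1 u1 u2 u3 (affmap O1 u1 u2 u3 (x, y, z)))).
  by rewrite affmapK.
rewrite /= !in_itv /= => -[[h1 h2] h3].
exists (affinv O1 u1 u2 u3 p).1.1, (affinv O1 u1 u2 u3 p).1.2, (affinv O1 u1 u2 u3 p).2.
by split => //; rewrite -{1}(affinvK O1 p nd).
Qed.

Lemma measurable_cube : measurable (C : set T3).
Proof.
rewrite cube_affinv -[X in measurable X]setTI.
apply: measurable_affinv => //.
by apply: measurableX; [apply: measurableX|]; exact: measurable_itv.
Qed.

(** Computed by the same change of frame as the simplex bounds, so that the factor [|det3 u1 u2 u3|]
    cancels in the average. *)
Lemma leb3_cube : @leb3 R C = `|det3 u1 u2 u3|%:E.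
Proof.
have mC := measurable_cube.
pose F : T3 -> \bar R := fun p => (\1_C p)%:E.
have mF : measurable_fun [set: T3] F.
  by apply/measurable_EFinP; exact: measurable_indic.
have F0 p : (0 <= F p)%E by rewrite lee_fin.
have -> : @leb3 R C = (\int[@leb3 R]_p F p)%E.
  by rewrite integral_indic // setIT.
rewrite (change_of_frameP O1 nd mF F0) -[RHS]mule1; congr (_ * _)%E.
have FE x y z : F (affmap O1 u1 u2 u3 (x, y, z)) = (\1_I x * \1_I y * \1_I z)%:E.
  rewrite /F; congr EFin.
  have -> : \1_C (affmap O1 u1 u2 u3 (x, y, z)) = \1_((I `*` I) `*` I) (x, y, z) :> R.
    have CI : C (affmap O1 u1 u2 u3 (x, y, z)) <-> ((I `*` I) `*` I) (x, y, z).
      rewrite cube_affinv.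
      change (((I `*` I) `*` I) (affinv O1 u1 u2 u3 (affmap O1 u1 u2 u3 (x, y, z))) <->
        ((I `*` I) `*` I) (x, y, z)).
      by rewrite affmapK.
    rewrite !indicE; congr (_%:R); congr nat_of_bool.
    by apply/idP/idP => /set_mem/CI/mem_set.
  rewrite !indicE -!natrM !mulnb; congr (_%:R); congr nat_of_bool.
  by rewrite !in_setX.
have int_I (c : R) : (0 <= c) -> (\int[mu]_z (c * \1_I z)%:E = c%:E)%E.
  move=> c0; have mI : measurable I by exact: measurable_itv.
  rewrite (eq_integral (fun z => c%:E * (\1_I z)%:E)%E) //.
  rewrite (ge0_integralZl_EFin mu measurableT _ _ c0); last 2 first.
  - by move=> z _; rewrite lee_fin.
  - by apply/measurable_EFinP; exact: measurable_indic.
  rewrite integral_indic // setIT [X in (_ * X)%E]lebesgue_measure_I mule1 //.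
rewrite /int3.
transitivity (\int[mu]_x \int[mu]_y (\1_I x * \1_I y : R)%:E)%E.
  apply: eq_integral => x _; apply: eq_integral => y _.
  rewrite -[RHS]int_I; last by rewrite mulr_ge0.
  by apply: eq_integral => z _; exact: FE.
transitivity (\int[mu]_x (1 * \1_I x : R)%:E)%E; last exact: int_I.
by apply: eq_integral => x _; rewrite int_I // mul1r.
Qed.

End Parallelepiped.
End Averages.

(** * Summing the edge bounds over the diagonal split *)

Section CubeAverage.
Variable R : realType.
Notation mu := (@lebesgue_measure R).
Notation T1 := (measurableTypeR R).
Notation T3 := (measurableTypeR R * measurableTypeR R * measurableTypeR R)%type.
Notation I := (`[0%R, 1%R]%classic : set T1).
Variables (O1 u1 u2 u3 : pt R).
Hypothesis nd : det3 u1 u2 u3 != 0.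
Let O2 := cube_O2 O1 u1 u2 u3.
Let V := cube_V O1 u1 u2 u3.
Let C := cube O1 u1 u2 u3.
Let T k := simplex4 O1 O2 (V k) (V k.+1).

(** Each simplex corresponds to one ordering of [x], [y], [z]. The weight of [O1] is one minus the
    largest coordinate, that of [O2] is the smallest, and the other two are the gaps between
    consecutive coordinates. Two of the eight sign patterns are cyclic and contradictory. *)
Lemma cube_subset : C `<=` \bigcup_k (if (k < 6)%N then T k else set0).
Proof.
move=> p [x [y [z [/andP[x0 x1] /andP[y0 y1] /andP[z0 z1] ->]]]].
have [xy|yx] := leP x y; have [yz|zy] := leP y z; have [xz|zx] := leP x z.
- exists 3%N => //=; exists (1 - z), x, (y - x), (z - y).
  split; [by apply/and4P; split; lra|ring|].
  by rewrite /O2 /V /cube_O2 /cube_V /= /padd /pscale /=; congr (_, _, _); ring.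
- by exfalso; lra.
- exists 2%N => //=; exists (1 - y), x, (y - z), (z - x).
  split; [by apply/and4P; split; lra|ring|].
  by rewrite /O2 /V /cube_O2 /cube_V /= /padd /pscale /=; congr (_, _, _); ring.
- exists 1%N => //=; exists (1 - y), z, (x - z), (y - x).
  split; [by apply/and4P; split; lra|ring|].
  by rewrite /O2 /V /cube_O2 /cube_V /= /padd /pscale /=; congr (_, _, _); ring.
- exists 4%N => //=; exists (1 - z), y, (z - x), (x - y).
  split; [by apply/and4P; split; lra|ring|].
  by rewrite /O2 /V /cube_O2 /cube_V /= /padd /pscale /=; congr (_, _, _); ring.
- exists 5%N => //=; exists (1 - x), y, (z - y), (x - z).
  split; [by apply/and4P; split; lra|ring|].
  by rewrite /O2 /V /cube_O2 /cube_V /= /padd /pscale /=; congr (_, _, _); ring.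
- by exfalso; lra.
- exists 0%N => //=; exists (1 - x), z, (x - y), (y - z).
  split; [by apply/and4P; split; lra|ring|].
  by rewrite /O2 /V /cube_O2 /cube_V /= /padd /pscale /=; congr (_, _, _); ring.
Qed.

Variable f : pt R -> R.
(* q k lists the vertices of the k-th simplex as two opposite edges. *)
Variable q : nat -> pt R * pt R * pt R * pt R.
Hypothesis qT : forall k, (k < 6)%N ->
  simplex4 (q k).1.1.1 (q k).1.1.2 (q k).1.2 (q k).2 = T k.
Hypothesis qD : forall k, (k < 6)%N ->
  `|det3 (psub (q k).1.1.2 (q k).1.1.1) (psub (q k).1.2 (q k).1.1.1)
     (psub (q k).2 (q k).1.1.1)| = `|det3 u1 u2 u3|.
Hypothesis cf : forall k, (k < 6)%N -> convex_on (T k) f.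

Let q_nd k : (k < 6)%N -> det3 (psub (q k).1.1.2 (q k).1.1.1)
  (psub (q k).1.2 (q k).1.1.1) (psub (q k).2 (q k).1.1.1) != 0.
Proof. by move=> k6; rewrite -normr_eq0 qD // normr_eq0. Qed.

Let q_cf k : (k < 6)%N ->
  convex_on (simplex4 (q k).1.1.1 (q k).1.1.2 (q k).1.2 (q k).2) f.
Proof. by move=> k6; rewrite qT //; exact: cf. Qed.

Let mT k : (k < 6)%N -> measurable (T k : set T3).
Proof. by move=> k6; rewrite -qT //; exact: measurable_simplex4 (q_nd k6). Qed.

Lemma cube_bounded : exists K, forall k p, (k < 6)%N -> T k p -> `|f p| <= K.
Proof.
have h k : exists M, (k < 6)%N -> forall p, T k p -> `|f p| <= M.
  have [k6|k6] := ltnP k 6; last by exists 0.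
  have [M fM] := bounded_simplex4 (q_nd k6) (q_cf k6).
  by exists M => _ p; rewrite -qT //; exact: fM.
have {h} [M fM] := choice h.
exists (\sum_(k < 6) `|M k|) => k p k6 Tp.
apply: le_trans (fM k k6 p Tp) _; apply: le_trans (ler_norm _) _.
rewrite (bigD1 (Ordinal k6)) //= lerDl.
by apply: sumr_ge0.
Qed.

(** The estimate is proved for the nonnegative [g = f + K]. Each of the twelve segment averages then
    gains [K], which the factor [|det3| / 12] turns into [K * |det3|], exactly the gain of the
    integral over the cube. *)
Lemma cube_avg_le :
  vol_avg C f <= 12^-1 * \sum_(k < 6)
    (seg_avg f (q k).1.1.1 (q k).1.1.2 + seg_avg f (q k).1.2 (q k).2).
Proof.
have mC : measurable (C : set T3) := measurable_cube O1 nd.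
have [K fK] := cube_bounded.
pose g (p : pt R) := f p + K.
have g0 k p : (k < 6)%N -> T k p -> 0 <= g p.
  by move=> k6 Tp; have := fK k p k6 Tp; rewrite ler_norml /g => /andP[? _]; lra.
have CT p : C p -> exists2 k, (k < 6)%N & T k p.
  by move=> /cube_subset[k _]; case: ifP => // k6; exists k.
have mf : measurable_fun (C : set T3) (f : T3 -> R).
  apply: measurable_funS cube_subset _.
    by apply: bigcupT_measurable => k; case: ifP => // k6; exact: mT.
  apply/measurable_fun_bigcup => k; first by case: ifP => // k6; exact: mT.
  case: ifP => k6; last exact: measurable_fun_set0.
  by have := measurable_fun_simplex4 (q_nd k6) (q_cf k6); rewrite qT.
have D0 : 0 < `|det3 u1 u2 u3| by rewrite normr_gt0.
have Coo : (@leb3 R C < +oo)%E by rewrite leb3_cube // ltry.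
have mg k : (k < 6)%N -> measurable_fun (T k : set T3) (EFin \o g : T3 -> \bar R).
  move=> k6; apply/measurable_EFinP.
  have := measurable_fun_simplex4 (q_nd k6) (convex_on_shift K (q_cf k6)).
  by rewrite qT.
have mgC : measurable_fun (C : set T3) (EFin \o g : T3 -> \bar R).
  by apply/measurable_EFinP; exact: measurable_funD.
have gC0 p : C p -> 0 <= g p by move=> /CT[k k6 Tp]; exact: g0 Tp.
(* Pointwise, [g] on the cube is one of the summands of the nonnegative sum of its restrictions to
   the [T k]; a point of several simplices only enlarges the right side. *)
have int_sum : (\int[@leb3 R]_(p in C) (g p)%:E <=
    \sum_(k < 6) \int[@leb3 R]_(p in T k) (g p)%:E)%E.
  pose G k : T3 -> \bar R := (EFin \o g) \_ (T k).
  have mG (k : 'I_6) : measurable_fun [set: T3] (G k).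
    by apply: (measurable_restrictT _ (mT (ltn_ord k))).1; exact: mg.
  have G0 (k : 'I_6) p : (0 <= G k p)%E.
    rewrite /G patchE; case: ifPn => // /set_mem Tp.
    by rewrite lee_fin; exact: g0 Tp.
  have -> : (\sum_(k < 6) \int[@leb3 R]_(p in T k) (g p)%:E =
      \int[@leb3 R]_p \sum_(k < 6) G k p)%E.
    rewrite (@ge0_integral_sum _ _ _ ((mu \x mu) \x mu)%E setT measurableT _
      (fun k : 'I_6 => G k)) //.
    by apply: eq_bigr => k _; exact: integral_mkcond.
  rewrite [leLHS](_ : _ = \int[@leb3 R]_p ((EFin \o g : T3 -> \bar R) \_ C) p)%E; last first.
    exact: integral_mkcond.
  apply: (@ge0_le_integral _ _ _ ((mu \x mu) \x mu)%E setT measurableT).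
  - move=> p _; rewrite patchE; case: ifPn => // /set_mem Cp.
    by rewrite lee_fin; exact: gC0.
  - exact: (measurable_restrictT _ mC).1.
  - by apply: emeasurable_sum => k; exact: mG.
  move=> p _; rewrite patchE; case: ifPn => [/set_mem Cp|_]; last exact: sume_ge0.
  have [k k6 Tp] := CT p Cp.
  rewrite (bigD1 (Ordinal k6)) //= {1}/G patchE mem_set //.
  by apply: leeDl; exact: sume_ge0.
have seg_le k : (k < 6)%N -> (\int[@leb3 R]_(p in T k) (g p)%:E <=
    (`|det3 u1 u2 u3| / 12 * (seg_avg f (q k).1.1.1 (q k).1.1.2 + K +
      (seg_avg f (q k).1.2 (q k).2 + K)))%:E)%E.
  move=> k6; have cg := convex_on_shift K (q_cf k6).
  have gT p : simplex4 (q k).1.1.1 (q k).1.1.2 (q k).1.2 (q k).2 p -> 0 <= g p.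
    by rewrite qT // => Tp; exact: g0 Tp.
  have := simplex_integral_le (q_nd k6) cg gT.
  rewrite qD // qT //.
  have avgE X Y : (forall r, I r -> simplex4 (q k).1.1.1 (q k).1.1.2 (q k).1.2 (q k).2 (seg X Y r)) ->
      (\int[mu]_(r in I) (g (padd X (pscale r (psub Y X))))%:E = (seg_avg f X Y + K)%:E)%E.
    move=> XY; have fi := seg_integrable (q_nd k6) (q_cf k6) XY.
    rewrite -(seg_avg_shift K fi) /seg_avg /Rintegral fineK //.
    have mI : measurable I by exact: measurable_itv.
    by have := integrable_fin_num mI (seg_integrable (q_nd k6) cg XY).
  rewrite (avgE _ _ (@simplex4_AB R _ _ _ _)) (avgE _ _ (@simplex4_CD R _ _ _ _)).
  by rewrite -EFinD -EFinM.
have int_le : (\int[@leb3 R]_(p in C) (g p)%:E <= (`|det3 u1 u2 u3| / 12 *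
    (\sum_(k < 6) (seg_avg f (q k).1.1.1 (q k).1.1.2 + seg_avg f (q k).1.2 (q k).2)
     + 12 * K))%:E)%E.
  apply: (le_trans int_sum).
  apply: (@le_trans _ _ (\sum_(k < 6) (`|det3 u1 u2 u3| / 12 *
     (seg_avg f (q k).1.1.1 (q k).1.1.2 + K + (seg_avg f (q k).1.2 (q k).2 + K)))%:E)%E).
    by apply: lee_sum => k _; exact: seg_le.
  rewrite sumEFin lee_fin -mulr_sumr le_eqVlt; apply/orP; left; apply/eqP.
  congr (_ * _); rewrite !big_ord_recl !big_ord0 /=; ring.
have int_eq : Rintegral (@leb3 R) C g = Rintegral (@leb3 R) C f + K * `|det3 u1 u2 u3|.
  have mi (h : T3 -> R) (M : R) : measurable_fun (C : set T3) h ->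
      (forall p, C p -> `|h p| <= M) -> ((mu \x mu) \x mu)%E.-integrable C (EFin \o h).
    by move=> mh hM; apply: integrable_of_bounded mC Coo mh hM.
  rewrite (@RintegralD _ _ _ ((mu \x mu) \x mu)%E C f (cst K)) //.
  - congr (_ + _); rewrite (@Rintegral_cst _ _ _ ((mu \x mu) \x mu)%E C mC).
    by congr (_ * _); rewrite [X in fine X](leb3_cube O1 nd).
  - by apply: (mi _ K mf) => p /CT[k k6 Tp]; exact: fK Tp.
  - by apply: (mi _ `|K|) => //; exact: measurable_cst.
(* Together with [int_le] this excludes the infinite values, which [fine] would send to 0. *)
have int_g0 : (0 <= \int[@leb3 R]_(p in C) (g p)%:E)%E.
  by apply: integral_ge0 => p Cp; rewrite lee_fin; exact: gC0.
have Rint_le : Rintegral (@leb3 R) C g <= `|det3 u1 u2 u3| / 12 *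
    (\sum_(k < 6) (seg_avg f (q k).1.1.1 (q k).1.1.2 + seg_avg f (q k).1.2 (q k).2)
     + 12 * K).
  move: int_g0 int_le; rewrite /Rintegral.
  by case: (\int[@leb3 R]_(p in C) (g p)%:E)%E.
rewrite /vol_avg leb3_cube //= ler_pdivrMr //.
rewrite -(lerD2r (K * `|det3 u1 u2 u3|)) -int_eq; apply: (le_trans Rint_le).
by rewrite le_eqVlt; apply/orP; left; apply/eqP; field.
Qed.

End CubeAverage.

(** * Edges and face diagonals of the cube *)

Section CubeSkeleton.
Variable R : realType.
Implicit Types (A B C D o : pt R) (f : pt R -> R).

Lemma simplex4_swapBC A B C D : simplex4 A B C D = simplex4 A C B D.
Proof.
suff H B' C' : simplex4 A B' C' D `<=` simplex4 A C' B' D.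
  by apply/seteqP; split; exact: H.
move=> p [a [b [c [d [/and4P[a0 b0 c0 d0] abcd ->]]]]].
exists a, c, b, d; split; [exact/and4P|lra|].
by rewrite /padd /pscale /=; congr (_, _, _); ring.
Qed.

Lemma simplex4_swapCD A B C D : simplex4 A B C D = simplex4 A B D C.
Proof.
suff H C' D' : simplex4 A B C' D' `<=` simplex4 A B D' C'.
  by apply/seteqP; split; exact: H.
move=> p [a [b [c [d [/and4P[a0 b0 c0 d0] abcd ->]]]]].
exists a, b, d, c; split; [exact/and4P|lra|].
by rewrite /padd /pscale /=; congr (_, _, _); ring.
Qed.

Lemma det3_swap12 A B C : `|det3 A B C| = `|det3 B A C|.
Proof. by rewrite -[LHS]normrN; congr `|_|; rewrite /det3; ring. Qed.

Lemma det3_swap23 A B C : `|det3 A B C| = `|det3 A C B|.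
Proof. by rewrite -[LHS]normrN; congr `|_|; rewrite /det3; ring. Qed.

Lemma psub_paddK o A : psub (padd o A) o = A.
Proof.
by case: A o => [[? ?] ?] [[? ?] ?]; rewrite /psub /padd /pscale /=; congr (_, _, _); ring.
Qed.

Lemma psub_paddl o A B : psub (padd o (padd A B)) (padd o A) = B.
Proof.
by case: o A B => [[? ?] ?] [[? ?] ?] [[? ?] ?];
  rewrite /psub /padd /pscale /=; congr (_, _, _); ring.
Qed.

Lemma psub_paddr o A B : psub (padd o (padd A B)) (padd o B) = A.
Proof.
by case: o A B => [[? ?] ?] [[? ?] ?] [[? ?] ?];
  rewrite /psub /padd /pscale /=; congr (_, _, _); ring.
Qed.

Lemma psub_O2_23 o A B C :
  psub (cube_O2 o A B C) (padd o (padd B C)) = A.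
Proof.
by case: o A B C => [[? ?] ?] [[? ?] ?] [[? ?] ?] [[? ?] ?];
  rewrite /cube_O2 /psub /padd /pscale /=; congr (_, _, _); ring.
Qed.

Lemma psub_O2_13 o A B C :
  psub (cube_O2 o A B C) (padd o (padd A C)) = B.
Proof.
by case: o A B C => [[? ?] ?] [[? ?] ?] [[? ?] ?] [[? ?] ?];
  rewrite /cube_O2 /psub /padd /pscale /=; congr (_, _, _); ring.
Qed.

Lemma psub_O2_12 o A B C :
  psub (cube_O2 o A B C) (padd o (padd A B)) = C.
Proof.
by case: o A B C => [[? ?] ?] [[? ?] ?] [[? ?] ?] [[? ?] ?];
  rewrite /cube_O2 /psub /padd /pscale /=; congr (_, _, _); ring.
Qed.

Lemma psub_O2_1 o A B C :
  psub (cube_O2 o A B C) (padd o A) = padd B C.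
Proof.
by case: o A B C => [[? ?] ?] [[? ?] ?] [[? ?] ?] [[? ?] ?];
  rewrite /cube_O2 /psub /padd /pscale /=; congr (_, _, _); ring.
Qed.

Lemma psub_O2_2 o A B C :
  psub (cube_O2 o A B C) (padd o B) = padd A C.
Proof.
by case: o A B C => [[? ?] ?] [[? ?] ?] [[? ?] ?] [[? ?] ?];
  rewrite /cube_O2 /psub /padd /pscale /=; congr (_, _, _); ring.
Qed.

Lemma psub_O2_3 o A B C :
  psub (cube_O2 o A B C) (padd o C) = padd A B.
Proof.
by case: o A B C => [[? ?] ?] [[? ?] ?] [[? ?] ?] [[? ?] ?];
  rewrite /cube_O2 /psub /padd /pscale /=; congr (_, _, _); ring.
Qed.

(** The simplices follow one another around the common axis in a fixed direction, so even the signs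
    of the determinants agree. *)
Lemma det3_cube_simplex o A B C k : (k < 6)%N ->
  det3 (psub (cube_O2 o A B C) o) (psub (cube_V o A B C k) o)
    (psub (cube_V o A B C k.+1) o) = det3 A B C.
Proof.
rewrite /cube_O2 psub_paddK.
by move: k => [|[|[|[|[|[|//]]]]]] _; rewrite /cube_V /= !psub_paddK /det3 /padd /=; ring.
Qed.

(** With a common length the weights cancel, and the weighted mean becomes a plain one. *)
Lemma union_avg6 f (l : R) (e0 e1 e2 e3 e4 e5 : pt R * pt R) : 0 < l ->
  seg_len e0.1 e0.2 = l -> seg_len e1.1 e1.2 = l -> seg_len e2.1 e2.2 = l ->
  seg_len e3.1 e3.2 = l -> seg_len e4.1 e4.2 = l -> seg_len e5.1 e5.2 = l ->
  union_avg f [:: e0; e1; e2; e3; e4; e5] = 6^-1 *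
    (seg_avg f e0.1 e0.2 + seg_avg f e1.1 e1.2 + seg_avg f e2.1 e2.2 +
     seg_avg f e3.1 e3.2 + seg_avg f e4.1 e4.2 + seg_avg f e5.1 e5.2).
Proof.
move=> l0 h0 h1 h2 h3 h4 h5.
rewrite /union_avg !big_cons !big_nil h0 h1 h2 h3 h4 h5; field.
by apply: lt0r_neq0; lra.
Qed.

Lemma sum_ord6 (F : nat -> R) :
  \sum_(k < 6) F k = F 0%N + F 1%N + F 2%N + F 3%N + F 4%N + F 5%N.
Proof. by rewrite !big_ord_recr big_ord0 /= add0r. Qed.

End CubeSkeleton.

Theorem theorem8p3 (R : realType) (O1 u1 u2 u3 : pt R) (f : pt R -> R) :
  is_cube u1 u2 u3 ->
  (forall k : nat, (k < 6)%N ->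
     convex_on (simplex4 O1 (cube_O2 O1 u1 u2 u3)
                  (cube_V O1 u1 u2 u3 k) (cube_V O1 u1 u2 u3 k.+1)) f) ->
  [/\ vol_avg (cube O1 u1 u2 u3) f <=
        2^-1 * seg_avg f O1 (cube_O2 O1 u1 u2 u3)
        + 2^-1 * union_avg f (cube_L O1 u1 u2 u3),
      vol_avg (cube O1 u1 u2 u3) f <= union_avg f (cube_P O1 u1 u2 u3) &
      vol_avg (cube O1 u1 u2 u3) f <= union_avg f (cube_S O1 u1 u2 u3)].
Proof.
move=> Q cf; have nd := is_cube_det3 Q.
set O2 := cube_O2 O1 u1 u2 u3; pose V := cube_V O1 u1 u2 u3.
have dk := @det3_cube_simplex R O1 u1 u2 u3.
pose qL k := (O1, O2, V k, V k.+1).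
(* V k is a neighbour of O1 for even k and of O2 for odd k, so qS pairs edges of
   the cube and qP pairs face diagonals. *)
pose qA k := (O1, V k, O2, V k.+1).
pose qB k := (O1, V k.+1, O2, V k).
pose qS k := if odd k then qB k else qA k.
pose qP k := if odd k then qA k else qB k.
have dA k : (k < 6)%N -> `|det3 (psub (V k) O1) (psub O2 O1) (psub (V k.+1) O1)|
    = `|det3 u1 u2 u3| by move=> k6; rewrite det3_swap12 dk.
have dB k : (k < 6)%N -> `|det3 (psub (V k.+1) O1) (psub O2 O1) (psub (V k) O1)|
    = `|det3 u1 u2 u3| by move=> k6; rewrite det3_swap12 det3_swap23 dk.
have TA k : simplex4 O1 (V k) O2 (V k.+1) = simplex4 O1 O2 (V k) (V k.+1).
  by rewrite simplex4_swapBC.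
have TB k : simplex4 O1 (V k.+1) O2 (V k) = simplex4 O1 O2 (V k) (V k.+1).
  by rewrite simplex4_swapBC simplex4_swapCD.
have V0 : V 0%N = padd O1 u1 by [].
have V1 : V 1%N = padd O1 (padd u1 u2) by [].
have V2 : V 2%N = padd O1 u2 by [].
have V3 : V 3%N = padd O1 (padd u2 u3) by [].
have V4 : V 4%N = padd O1 u3 by [].
have V5 : V 5%N = padd O1 (padd u1 u3) by [].
have V6 : V 6%N = padd O1 u1 by [].
pose n := pdot u1 u1.
have [[h12 h13 h23] [n12 n23 n0]] := Q.
have n2 : pdot u2 u2 = n by rewrite -n12.
have n3 : pdot u3 u3 = n by rewrite -n23 n2.
have ln0 : 0 < Num.sqrt n by rewrite sqrtr_gt0.
have l2n0 : 0 < Num.sqrt (2 * n) by rewrite sqrtr_gt0 mulr_gt0.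
have len1 X Y w : pdot w w = n -> psub Y X = w \/ psub X Y = w -> seg_len X Y = Num.sqrt n.
  move=> wn h; rewrite /seg_len; congr Num.sqrt; case: h => h; rewrite -wn -h.
    by [].
  by rewrite /pdot /psub /padd /pscale /=; ring.
have len2 X Y (w w' : pt R) : pdot w w' = 0 -> pdot w w = n -> pdot w' w' = n ->
    psub Y X = padd w w' \/ psub X Y = padd w w' -> seg_len X Y = Num.sqrt (2 * n).
  move=> ww' wn wn' h; rewrite /seg_len; congr Num.sqrt.
  have -> : 2 * n = pdot (padd w w') (padd w w').
    rewrite (_ : pdot (padd w w') _ = pdot w w + pdot w' w' + 2 * pdot w w').
      by rewrite ww' wn wn'; ring.
    by rewrite /pdot /padd /=; ring.
  by case: h => <- //; rewrite /pdot /psub /padd /pscale /=; ring.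
split.
- rewrite (_ : cube_L O1 u1 u2 u3 = [:: (V 0, V 1); (V 1, V 2); (V 2, V 3);
    (V 3, V 4); (V 4, V 5); (V 5, V 6)]%N) // (union_avg6 f ln0) /=.
  (* The axis occurs in all six simplices, which gives [6 / 12]; each segment of the closed line
     occurs once, and [12^-1] is half of [6^-1]. *)
  + have := @cube_avg_le R O1 u1 u2 u3 nd f qL (fun k _ => erefl) _ cf.
    rewrite (sum_ord6 (fun k => seg_avg f (qL k).1.1.1 (qL k).1.1.2 +
      seg_avg f (qL k).1.2 (qL k).2)) /qL /=.
    move=> /(_ (fun k k6 => congr1 Num.norm (dk k k6))).
    set v := vol_avg _ _; set a := seg_avg _ _ _; lra.
  + by apply: (len1 _ _ u2) => //; left; exact: psub_paddl.
  + by apply: (len1 _ _ u1) => //; right; exact: psub_paddr.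
  + by apply: (len1 _ _ u3) => //; left; exact: psub_paddl.
  + by apply: (len1 _ _ u2) => //; right; exact: psub_paddr.
  + by apply: (len1 _ _ u1) => //; left; exact: psub_paddr.
  + by apply: (len1 _ _ u3) => //; right; exact: psub_paddl.
- rewrite /cube_P -/O2 (union_avg6 f l2n0) /=.
  (* Each [V k] belongs to two neighbouring simplices, and the alternation by parity joins it to the
     same axis endpoint in both. Every diagonal thus occurs twice among the twelve terms, turning
     [12^-1] into [6^-1]. *)
  + have := @cube_avg_le R O1 u1 u2 u3 nd f qP _ _ cf.
    rewrite (sum_ord6 (fun k => seg_avg f (qP k).1.1.1 (qP k).1.1.2 +
      seg_avg f (qP k).1.2 (qP k).2)) /qP /qA /qB /= V0 V1 V2 V3 V4 V5 V6 => h.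
    apply: le_trans (h _ _) _.
    * by move=> k _; case: (odd k); [exact: TA|exact: TB].
    * by move=> k k6; case: (odd k); [exact: dA|exact: dB].
    lra.
  + by apply: (len2 _ _ u1 u2) => //; left; exact: psub_paddK.
  + by apply: (len2 _ _ u1 u3) => //; left; exact: psub_paddK.
  + by apply: (len2 _ _ u2 u3) => //; left; exact: psub_paddK.
  + by apply: (len2 _ _ u2 u3) => //; right; exact: psub_O2_1.
  + by apply: (len2 _ _ u1 u3) => //; right; exact: psub_O2_2.
  + by apply: (len2 _ _ u1 u2) => //; right; exact: psub_O2_3.
- rewrite /cube_S -/O2 (union_avg6 f ln0) /=.
  (* The opposite parity joins each [V k] to its adjacent axis endpoint, so every edge of [S] again
     occurs twice. *)
  + have := @cube_avg_le R O1 u1 u2 u3 nd f qS _ _ cf.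
    rewrite (sum_ord6 (fun k => seg_avg f (qS k).1.1.1 (qS k).1.1.2 +
      seg_avg f (qS k).1.2 (qS k).2)) /qS /qA /qB /= V0 V1 V2 V3 V4 V5 V6 => h.
    apply: le_trans (h _ _) _.
    * by move=> k _; case: (odd k); [exact: TB|exact: TA].
    * by move=> k k6; case: (odd k); [exact: dB|exact: dA].
    lra.
  + by apply: (len1 _ _ u1) => //; left; exact: psub_paddK.
  + by apply: (len1 _ _ u2) => //; left; exact: psub_paddK.
  + by apply: (len1 _ _ u3) => //; left; exact: psub_paddK.
  + by apply: (len1 _ _ u1) => //; right; exact: psub_O2_23.
  + by apply: (len1 _ _ u2) => //; right; exact: psub_O2_13.
  + by apply: (len1 _ _ u3) => //; right; exact: psub_O2_12.
Qed.
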